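(* Let $\mathcal{H}$ be a nonzero complex Hilbert space, let $A,D\in\mathcal{B}(\mathcal{H})$ be positive, and let $f$ be a non-negative increasing operator convex function on $[0,\infty)$. Then $$f(\|AD\|)\le\left\|\int_0^1 f\left((1-t)\left(\frac{A+D}{2}\right)^2+t\|AD\|I\right)dt\right\|\le\left\|f\left(\left(\frac{A+D}{2}\right)^2\right)\right\|.$$
   Context: $\mathcal{B}(\mathcal{H})$ is the set of bounded linear operators on $\mathcal{H}$, $I$ is the identity operator, and $\|\cdot\|$ is the operator norm. An operator $A$ is positive if $\langle Ax,x\rangle\ge0$ for all $x\in\mathcal{H}$. A real-valued continuous function $f$ on an interval $J$ is operator convex if for all selfadjoint operators $S,T\in\mathcal{B}(\mathcal{H})$ with spectra contained in $J$ one has $f((1-t)S+tT)\le(1-t)f(S)+tf(T)$ for all $t\in[0,1]$, where $f$ of a selfadjoint operator is given by the continuous functional calculus and $\le$ is the usual order on selfadjoint operators. The integral is the integral over $[0,1]$ of a norm-continuous operator-valued function. *)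

(* Defs.v *)
From HB Require Import structures.
From mathcomp Require Import all_boot all_order all_algebra.
From mathcomp Require Import complex.
From mathcomp Require Import all_classical all_reals all_analysis.

Set Implicit Arguments.
Unset Strict Implicit.
Unset Printing Implicit Defensive.

Import Order.TTheory GRing.Theory Num.Theory.
Import numFieldNormedType.Exports.

Local Open Scope classical_set_scope.
Local Open Scope complex_scope.
Local Open Scope ring_scope.

(* Operators are functions [H -> H], with the pointwise vector-space structure
   of mathcomp-classical, composition [\o] as product and [idfun] as identity.
   The norm of [H : normedModType R[i]] takes its values in the nonnegative
   reals of [R[i]], and [0 <= z] for [z : R[i]] means that [z] is real and
   nonnegative. *)

Section BoundedOperators.
Variables (R : realType) (H : normedModType R[i]).
Implicit Types (S T B : H -> H) (f : R -> R).

Definition bounded_operator T :=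
  linear T /\ exists M : R, forall x, `|T x| <= M%:C * `|x|.

(* Meaningful for bounded operators only: [sup] is 0 on an unbounded set. *)
Definition opnorm T : R :=
  sup [set complex.Re `|T x| | x in [set x : H | `|x| <= 1]].

Definition invertible_operator T :=
  exists S, [/\ bounded_operator S, T \o S = idfun & S \o T = idfun].

Definition spectrum T : set R[i] :=
  [set l | ~ invertible_operator (T - l *: idfun)].

Definition real_spectrum T : set R := [set r | spectrum T r%:C].

Definition poly_operator (p : {poly R}) T : H -> H :=
  \sum_(i < size p) (p`_i)%:C *: iter i T.

(* [B] is the image of [f] under the isometric extension of [p |-> p(T)] from
   the real polynomials to the continuous functions on the spectrum of [T]. *)
Definition is_cfc f T B :=
  bounded_operator B /\
  exists p : nat -> {poly R},
    {uniform real_spectrum T, (fun n => horner (p n)) @ \oo --> f} /\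
    opnorm (poly_operator (p n) T - B) @[n --> \oo] --> (0 : R).

(* For a bounded selfadjoint [T] on a Hilbert space the limit is unique, and it
   exists when [f] is continuous on the spectrum of [T]; 0 is a junk value. *)
Definition cfc f T : H -> H := xget 0 [set B | is_cfc f T B].

(* The partition a = s_(-1) < s_0 < ... < s_(n-1) = b is stored as the sequence
   [s], without its first point; [xi] lists the tags. *)
Definition riemann_sum (a : R) (G : R -> H -> H) (s : seq R) (xi : nat -> R)
    : H -> H :=
  \sum_(i < size s) (s`_i - (a :: s)`_i)%:C *: G (xi i).

Definition is_opint (a b : R) (G : R -> H -> H) B :=
  (forall t, a <= t <= b -> bounded_operator (G t)) /\ bounded_operator B /\
  forall e : R, 0 < e -> exists2 d : R, 0 < d &
    forall (s : seq R) (xi : nat -> R), itv_partition a b s ->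
      (forall i, (i < size s)%N ->
        (a :: s)`_i <= xi i <= s`_i /\ s`_i - (a :: s)`_i < d) ->
      opnorm (riemann_sum a G s xi - B) < e.

(* Riemann integral in operator norm of a family of bounded operators. *)
Definition opint (a b : R) (G : R -> H -> H) : H -> H :=
  xget 0 [set B | is_opint a b G B].

End BoundedOperators.

Section OperatorOrder.
Variables (R : realType) (H : normedModType R[i]) (dot : {dot H for Num.conj}).
Implicit Types (S T : H -> H) (f : R -> R).

Definition selfadjoint T := forall x y, dot (T x) y = dot x (T y).

Definition positive_operator T := forall x, 0 <= dot (T x) x.

Definition operator_le S T := positive_operator (T - S).

Definition operator_convex (J : interval R) f :=
  {within [set` J], continuous f} /\
  forall S T, bounded_operator S -> bounded_operator T ->
    selfadjoint S -> selfadjoint T ->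
    spectrum S `<=` [set r%:C | r in [set` J]] ->
    spectrum T `<=` [set r%:C | r in [set` J]] ->
    forall t : R, 0 <= t <= 1 ->
      operator_le (cfc f ((1 - t)%:C *: S + t%:C *: T))
                  ((1 - t)%:C *: cfc f S + t%:C *: cfc f T).

End OperatorOrder.

(* Main.v *)
(* Put [S = ((A + D) / 2) ^ 2], [m = ||S||] and [N = ||A D||].  Since the operators
   [(1 - t) S + t N I] are affine functions of [S], the integral equals [h(S)] for
   the scalar function [h(x) = \int_0^1 f((1 - t) x + t N) dt].  The norm of [h(S)]
   lies between [h(m)], because [m] is in the spectrum of [S], and the supremum
   of [h] over [[0, m]].  By Bhatia and Kittaneh's inequality [N <= m]; as [f] is
   increasing, [f(N) <= h(m)] and [h <= f(m) = ||f(S)||] on [[0, m]]. *)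

Require Import Defs.
From HB Require Import structures.
From mathcomp Require Import all_boot all_order all_algebra.
From mathcomp Require Import complex.
From mathcomp Require Import all_classical all_reals all_analysis.
From mathcomp Require Import ring lra.

Set Implicit Arguments.
Unset Strict Implicit.
Unset Printing Implicit Defensive.

Import Order.TTheory GRing.Theory Num.Theory.
Import numFieldNormedType.Exports.

Local Open Scope classical_set_scope.
Local Open Scope complex_scope.
Local Open Scope ring_scope.

(** Invertibility is always obtained from coercivity: an operator whose quadratic form dominates a
    positive multiple of the squared norm is inverted by a contraction, which is where completeness
    first enters. This confines the spectrum of a positive operator to [[0, opnorm T]]; together
    with the splitting of complex polynomials it shows that the norm of [p(T)] is the supremum of
    [|p|] over the spectrum, and the functional calculus follows by Bernstein approximation. Bhatia
    and Kittaneh's inequality is derived from Cauchy-Schwarz for the forms [<A x, y>] and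
    [<D x, y>], without operator square roots. In infinite dimension the norm [m] of [A D] need not
    be attained, so the extremal relation [D A A D x = m ^ 2 x] is available only up to an error,
    and the argument has to be quantitative. The scalar function [h] is handled as an increment of
    an antiderivative: the mean value theorem gives [h(x) = f((1 - t) x + t N)] for some [t]
    depending on [x], and every bound on [h] is read off from this. *)

Section Norm.
Variables (R : realType) (H : normedModType R[i]).
Implicit Types (x y z : H) (S T B : H -> H) (c : R).

(** The norm of [H] lives in [R[i]]; a copy in [R] has a total order and is within reach of
    [lra]. *)
Definition rnorm x : R := complex.Re `|x|.

Lemma rnormE x : `|x| = (rnorm x)%:C.
Proof. by rewrite /rnorm RRe_real// normr_real. Qed.

Lemma rnorm_ge0 x : 0 <= rnorm x.
Proof. by have := normr_ge0 x; rewrite rnormE ler0c. Qed.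

Lemma rnorm_eq0 x : rnorm x = 0 -> x = 0.
Proof. by move=> x0; apply/eqP; rewrite -normr_eq0 rnormE x0. Qed.

Lemma rnorm0 : rnorm 0 = 0.
Proof. by rewrite /rnorm normr0. Qed.

Lemma rnormD x y : rnorm (x + y) <= rnorm x + rnorm y.
Proof. by rewrite -lecR rmorphD/= -!rnormE ler_normD. Qed.

Lemma rnormZ (a : R[i]) x : rnorm (a *: x) = complex.Re `|a| * rnorm x.
Proof.
by rewrite /rnorm normrZ -/(rnorm x) rnormE -[`|a|]RRe_real ?normr_real// -rmorphM.
Qed.

Lemma normCR c : `|c%:C| = `|c|%:C :> R[i].
Proof. by rewrite normc_def /= expr0n/= addr0 sqrtr_sqr. Qed.

Lemma rnormZR c x : rnorm (c%:C *: x) = `|c| * rnorm x.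
Proof. by rewrite rnormZ normCR. Qed.

Lemma rnormN x : rnorm (- x) = rnorm x.
Proof. by rewrite /rnorm normrN. Qed.

Lemma rnormB x y : rnorm (x - y) = rnorm (y - x).
Proof. by rewrite /rnorm distrC. Qed.

Lemma rnorm_eps x : (forall e, 0 < e -> rnorm x <= e) -> x = 0.
Proof.
move=> xe; apply: rnorm_eq0; apply/eqP; rewrite eq_le rnorm_ge0 andbT.
by apply/ler_addgt0Pl => e /xe; rewrite addr0.
Qed.

Lemma boundedP T : bounded_operator T <->
  linear T /\ exists2 c, 0 <= c & forall x, rnorm (T x) <= c * rnorm x.
Proof.
split=> [[lT [c Tc]]|[lT [c c0 Tc]]]; split => //; last first.
  by exists c => x; rewrite !rnormE -rmorphM/= lecR.
(* The constant in [bounded_operator] is not assumed nonnegative. *)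
exists `|c| => // x; have := Tc x; rewrite !rnormE -rmorphM/= lecR => /le_trans.
by apply; apply: ler_wpM2r; rewrite ?rnorm_ge0// ler_norm.
Qed.

Let unit_image T := [set complex.Re `|T x| | x in [set x : H | `|x| <= 1]].

Let le1E x : (`|x| <= 1) = (rnorm x <= 1).
Proof. by rewrite rnormE -[1]/(1%:C) lecR. Qed.

Lemma opnorm_le T c : 0 <= c -> (forall x, rnorm (T x) <= c * rnorm x) ->
  opnorm T <= c.
Proof.
move=> c0 Tc; apply: ge_sup; first by exists (rnorm (T 0)), 0; rewrite /= ?normr0.
move=> y [x /= +] <-; rewrite le1E => x1.
by rewrite (le_trans (Tc x))// ler_piMr.
Qed.

Lemma linear_at0 T : linear T -> T 0 = 0.
Proof. by move=> lT; have := lT (-1) 0 0; rewrite scaler0 addr0 scaleN1r addNr. Qed.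

Lemma linear_atZ T (a : R[i]) x : linear T -> T (a *: x) = a *: T x.
Proof. by move=> lT; have := lT a x 0; rewrite !addr0 linear_at0// addr0. Qed.

Lemma linear_atD T x y : linear T -> T (x + y) = T x + T y.
Proof. by move=> lT; have := lT 1 x y; rewrite !scale1r. Qed.

Lemma linear_atN T x : linear T -> T (- x) = - T x.
Proof. by move=> lT; rewrite -scaleN1r linear_atZ// scaleN1r. Qed.

Lemma linear_atB T x y : linear T -> T (x - y) = T x - T y.
Proof. by move=> lT; rewrite linear_atD// linear_atN. Qed.

Lemma rnorm_opnorm T x : bounded_operator T ->
  rnorm (T x) <= opnorm T * rnorm x.
Proof.
move=> /boundedP[lT [c c0 Tc]].
have [/rnorm_eq0 ->|x0] := eqVneq (rnorm x) 0.
  by rewrite linear_at0// rnorm0 mulr0.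
have xgt0 : 0 < rnorm x by rewrite lt_def x0 rnorm_ge0.
rewrite -ler_pdivrMr// mulrC -(gtr0_norm (_ : 0 < (rnorm x)^-1)) ?invr_gt0//.
rewrite -rnormZR -linear_atZ//.
apply: ub_le_sup; last first.
  exists (((rnorm x)^-1)%:C *: x) => //=.
  by rewrite le1E rnormZR gtr0_norm ?invr_gt0// mulVf.
exists c => z [y /= +] <-; rewrite le1E => y1.
by rewrite (le_trans (Tc y))// ler_piMr.
Qed.

Lemma opnorm_ge0 T : bounded_operator T -> 0 <= opnorm T.
Proof.
move=> /boundedP[lT [c c0 Tc]]; apply: ub_le_sup => /=; last first.
  by exists 0; rewrite /= ?normr0 ?ler01// linear_at0// normr0.
exists c => z [y /= +] <-; rewrite le1E => y1.
by rewrite (le_trans (Tc y))// ler_piMr.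
Qed.

End Norm.

(** Common source of the Cauchy-Schwarz inequalities below: [a], [b], [c] are the values of a form,
    possibly degenerate, on a pair of vectors. *)
Lemma discriminant_le (R : realFieldType) (a b c : R) : 0 <= a -> 0 <= c ->
  (forall t, 0 <= a + 2 * t * b + t ^+ 2 * c) -> b ^+ 2 <= a * c.
Proof.
move=> a0; rewrite le_eqVlt => /predU1P[<-|c0] q.
  have [->|b0] := eqVneq b 0; first by rewrite expr0n mulr0.
  (* For [c = 0] the expression is affine in [t] with nonzero slope, and it equals [-1] at this
     point. *)
  have := q (- (a + 1) / (2 * b)).
  have -> : a + 2 * (- (a + 1) / (2 * b)) * b + (- (a + 1) / (2 * b)) ^+ 2 * 0 = -1.
    by field.
  by rewrite oppr_ge0 ler10.
(* The minimizer of the quadratic. *)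
have := q (- b / c).
have -> : a + 2 * (- b / c) * b + (- b / c) ^+ 2 * c = a - b ^+ 2 / c.
  by field; rewrite gt_eqF.
by rewrite subr_ge0 ler_pdivrMr.
Qed.

(** * The real inner product *)

Section InnerProduct.
Variables (R : realType) (H : normedModType R[i]) (dot : {dot H for Num.conj}).
Implicit Types (x y z : H) (S T : H -> H) (c : R).

Definition rdot x y : R := complex.Re (dot x y).

Lemma ReD (a b : R[i]) : complex.Re (a + b) = complex.Re a + complex.Re b.
Proof. by case: a b => ? ? []. Qed.

Lemma ReN (a : R[i]) : complex.Re (- a) = - complex.Re a.
Proof. by case: a. Qed.

Lemma ReMl c (a : R[i]) : complex.Re (c%:C * a) = c * complex.Re a.
Proof. by case: a => ? ? /=; rewrite mul0r subr0. Qed.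

Lemma dotC x y : dot x y = (dot y x)^*%C.
Proof. by have := hermC dot x y; rewrite expr0 mul1r. Qed.

Lemma dotDl x y z : dot (x + y) z = dot x z + dot y z.
Proof. exact: linearDl. Qed.

Lemma dotZl (a : R[i]) x y : dot (a *: x) y = a * dot x y.
Proof. exact: linearZl_LR. Qed.

Lemma dotDr x y z : dot z (x + y) = dot z x + dot z y.
Proof. exact: linearDr. Qed.

Lemma dotZr (a : R[i]) x y : dot y (a *: x) = a^*%C * dot y x.
Proof. exact: linearZr_LR. Qed.

Lemma rdotDl x y z : rdot (x + y) z = rdot x z + rdot y z.
Proof. by rewrite /rdot dotDl ReD. Qed.

Lemma rdotZl c x y : rdot (c%:C *: x) y = c * rdot x y.
Proof. by rewrite /rdot dotZl ReMl. Qed.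

Lemma rdotNl x y : rdot (- x) y = - rdot x y.
Proof. by rewrite /rdot -scaleN1r dotZl mulN1r ReN. Qed.

Lemma rdotC x y : rdot x y = rdot y x.
Proof.
by rewrite /rdot dotC; case: (dot y x).
Qed.

Lemma rdotDr x y z : rdot z (x + y) = rdot z x + rdot z y.
Proof. by rewrite !(rdotC z) rdotDl. Qed.

Lemma rdotZr c x y : rdot y (c%:C *: x) = c * rdot y x.
Proof. by rewrite !(rdotC y) rdotZl. Qed.

Lemma rdotNr x y : rdot y (- x) = - rdot y x.
Proof. by rewrite !(rdotC y) rdotNl. Qed.

Definition rdotE := (rdotDl, rdotDr, rdotZl, rdotZr, rdotNl, rdotNr).

Section Positive.
Variable T : H -> H.
Hypotheses (lT : linear T) (T_ge0 : positive_operator dot T).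

Lemma positive_rdot x : 0 <= rdot (T x) x.
Proof. by have := T_ge0 x; rewrite lecE => /andP[]. Qed.

Lemma positive_Im x : complex.Im (dot (T x) x) = 0.
Proof. by have := T_ge0 x; rewrite lecE => /andP[/eqP]. Qed.

(** Complex polarization: the imaginary part of [dot (T z) z] vanishes at [z = x + 'i *: y], and its
    cross terms there are, up to sign, the difference of the two sides. *)
Lemma positive_rdotC x y : rdot (T x) y = rdot x (T y).
Proof.
have := positive_Im (x + 'i *: y); have := positive_Im x; have := positive_Im ('i *: y).
rewrite linear_atD// linear_atZ// dotDl !dotDr !dotZl !dotZr.
rewrite (rdotC x) /rdot.
case: (dot (T x) x) => a1 a2; case: (dot (T y) y) => b1 b2.
case: (dot (T x) y) => c1 c2; case: (dot (T y) x) => d1 d2.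
rewrite /= => h1 h2 h3; lra.
Qed.

(** The symmetry of the real parts, applied at ['i *: x], gives that of the imaginary parts. *)
Lemma positive_selfadjoint : selfadjoint dot T.
Proof.
move=> x y; have := positive_rdotC ('i *: x) y; have := positive_rdotC x y.
rewrite linear_atZ// /rdot !dotZl.
case: (dot (T x) y) => a b; case: (dot x (T y)) => c d /= ac bd.
by congr (_ +i* _); lra.
Qed.

Lemma positive_cauchy_schwarz x y :
  rdot (T x) y ^+ 2 <= rdot (T x) x * rdot (T y) y.
Proof.
apply: discriminant_le => [||t]; try exact: positive_rdot.
have := positive_rdot (x + t%:C *: y).
rewrite linear_atD// linear_atZ// !rdotE (positive_rdotC y) (rdotC y).
by congr (0 <= _); ring.
Qed.

End Positive.

Hypothesis norm_dot : forall x, `|x| ^+ 2 = dot x x.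

Lemma rdotxx x : rdot x x = rnorm x ^+ 2.
Proof. by rewrite /rdot -norm_dot rnormE -rmorphXn. Qed.

Lemma cauchy_schwarz x y : rdot x y <= rnorm x * rnorm y.
Proof.
apply: le_trans (ler_norm _) _.
rewrite -ler_sqr ?nnegrE ?mulr_ge0 ?rnorm_ge0// real_normK ?num_real// exprMn.
rewrite -!rdotxx; apply: discriminant_le; rewrite ?rdotxx ?sqr_ge0// => t.
have : 0 <= rdot (x + t%:C *: y) (x + t%:C *: y) by rewrite rdotxx sqr_ge0.
by rewrite !rdotE (rdotC y) !rdotxx; congr (0 <= _); ring.
Qed.

Lemma norm_cauchy_schwarz x y : `|rdot x y| <= rnorm x * rnorm y.
Proof. by rewrite ler_norml lerNl -rdotNl -{1}(rnormN x) !cauchy_schwarz. Qed.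


End InnerProduct.

Lemma opnorm_sqr_le (R : realType) (H : normedModType R[i]) (T : H -> H) (s : R) :
  bounded_operator T -> 0 <= s ->
  (forall x, rnorm (T x) ^+ 2 <= s * rnorm x ^+ 2) -> opnorm T ^+ 2 <= s.
Proof.
move=> bT s0 Ts; rewrite -(sqr_sqrtr s0) ler_sqr ?nnegrE ?opnorm_ge0 ?sqrtr_ge0//.
apply: opnorm_le (sqrtr_ge0 _) _ => x.
by rewrite -ler_sqr ?nnegrE ?mulr_ge0 ?rnorm_ge0 ?sqrtr_ge0// exprMn sqr_sqrtr.
Qed.

Lemma bounded_comp (R : realType) (H : normedModType R[i]) (S T : H -> H) :
  bounded_operator S -> bounded_operator T -> bounded_operator (S \o T).
Proof.
move=> /boundedP[lS [a a0 Sa]] /boundedP[lT [b b0 Tb]]; apply/boundedP; split.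
  by move=> c x y /=; rewrite lT lS.
exists (a * b) => [|x /=]; first exact: mulr_ge0.
by rewrite (le_trans (Sa _))// -mulrA ler_wpM2l.
Qed.

(** * The norm of a product of positive operators *)

Section NormInequality.
Variables (R : realType) (H : normedModType R[i]) (dot : {dot H for Num.conj}).
Hypothesis norm_dot : forall x : H, `|x| ^+ 2 = dot x x.
Variables A D : H -> H.
Hypotheses (bA : bounded_operator A) (bD : bounded_operator D).
Hypotheses (A_ge0 : positive_operator dot A) (D_ge0 : positive_operator dot D).
Variable k : R.
Hypotheses (k_ge0 : 0 <= k).
Hypotheses (ADk : forall x, rnorm (A x + D x) <= k * rnorm x).

Local Notation "''[' u , v ]" := (rdot dot u v) : ring_scope.
Let lA : linear A := bA.1.
Let lD : linear D := bD.1.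

Let sum_le z : '[A z + D z, z] <= k * rnorm z ^+ 2.
Proof.
rewrite (le_trans (cauchy_schwarz norm_dot _ _))// expr2 mulrA.
by rewrite ler_wpM2r// rnorm_ge0.
Qed.

(* The pairing [<(a, b), (c, d)> = '[A a, c] + '[D b, d]] is a nonnegative form;
   apply Cauchy-Schwarz to it at [(q, p)] and [(z, z)]. *)
Lemma rnorm_sum_sqr_le (p q : H) :
  rnorm (A q + D p) ^+ 2 <= k * ('[A q, q] + '[D p, p]).
Proof.
have [z zE] : exists z, z = A q + D p by exists (A q + D p).
rewrite -zE; set c := '[A q, q] + '[D p, p].
have c0 : 0 <= c by rewrite addr_ge0 ?positive_rdot.
have : rnorm z ^+ 2 ^+ 2 <= c * '[A z + D z, z].
  rewrite -(rdotxx norm_dot) {1}zE rdotDl; apply: discriminant_le => //.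
    by rewrite rdotDl addr_ge0 ?positive_rdot.
  move=> t; have := positive_rdot A_ge0 (q + t%:C *: z).
  have := positive_rdot D_ge0 (p + t%:C *: z).
  rewrite !(linear_atD _ _ lA, linear_atD _ _ lD, linear_atZ _ _ lA, linear_atZ _ _ lD).
  rewrite !rdotE. rewrite (positive_rdotC lA A_ge0 z q) (positive_rdotC lD D_ge0 z p).
  rewrite (rdotC _ z (A q)) (rdotC _ z (D p)) /c => h1 h2.
  have := addr_ge0 h1 h2; congr (0 <= _); ring.
have [->|z0] := eqVneq (rnorm z) 0; first by rewrite expr0n/= mulr_ge0.
move=> /le_trans /(_ (ler_wpM2l c0 (sum_le z))).
rewrite mulrA (expr2 (rnorm z ^+ 2)) ler_pM2r 1?mulrC//.
by rewrite exprn_gt0// lt_def z0 rnorm_ge0.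
Qed.

(** Polarization: with [B = A + D], the left side is [<B (u + v), u + v> - <B (u - v), u - v>], and
    the subtracted term is nonnegative. *)
Lemma four_rdot_le (u v : H) : 4 * '[A u + D u, v] <= k * rnorm (u + v) ^+ 2.
Proof.
apply: le_trans (sum_le _).
have := positive_rdot A_ge0 (u - v); have := positive_rdot D_ge0 (u - v).
rewrite !(linear_atD _ _ lA, linear_atD _ _ lD, linear_atN _ lA, linear_atN _ lD).
rewrite !rdotE (positive_rdotC lA A_ge0 v u) (positive_rdotC lD D_ge0 v u).
rewrite (rdotC _ v (A u)) (rdotC _ v (D u)) => h1 h2; lra.
Qed.

(** This is [D ^ 2 <= d D]. Cauchy-Schwarz for the form of [D] at [p] and [D p] bounds [||D p|| ^ 4]
    by [<D p, p>] times [d ||D p|| ^ 2]. *)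
Lemma positive_rnorm_sqr_le (d : R) (p : H) : 0 <= d ->
  (forall x, rnorm (D x) <= d * rnorm x) -> rnorm (D p) ^+ 2 <= d * '[D p, p].
Proof.
move=> d0 Dd; have := positive_cauchy_schwarz lD D_ge0 p (D p).
rewrite (rdotxx norm_dot); have Dp0 := positive_rdot D_ge0 p.
have DD : '[D (D p), D p] <= d * rnorm (D p) ^+ 2.
  rewrite (le_trans (cauchy_schwarz norm_dot _ _))// expr2 mulrA.
  by rewrite ler_wpM2r// rnorm_ge0.
have [->|z0] := eqVneq (rnorm (D p)) 0; first by rewrite expr0n/= mulr_ge0.
move=> /le_trans /(_ (ler_wpM2l Dp0 DD)).
rewrite mulrA (expr2 (rnorm (D p) ^+ 2)) ler_pM2r 1?mulrC//.
by rewrite exprn_gt0// lt_def z0 rnorm_ge0.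
Qed.

(** [D A] is the adjoint of [A D], so it obeys the same bound: for [z = D A w] one has
    [||z|| ^ 2 = <w, A D z>]. *)
Lemma rnorm_comp_le (w : H) : rnorm (D (A w)) <= opnorm (A \o D) * rnorm w.
Proof.
set z := D (A w); have [->|z0] := eqVneq (rnorm z) 0.
  by rewrite mulr_ge0 ?rnorm_ge0 ?opnorm_ge0//; exact: bounded_comp.
have {}z0 : 0 < rnorm z by rewrite lt_def z0 rnorm_ge0.
rewrite -(ler_pM2r z0) -expr2 -(rdotxx norm_dot).
rewrite {1}/z (positive_rdotC lD D_ge0) (positive_rdotC lA A_ge0).
rewrite (le_trans (cauchy_schwarz norm_dot _ _))// mulrC mulrAC.
rewrite ler_wpM2r ?rnorm_ge0//.
exact: (rnorm_opnorm z (bounded_comp bA bD)).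
Qed.

(* Let [m] be the norm of [A D] and suppose [4 m > k ^ 2].  With [q = A D x / m],
   [u = A q] and [v = D x] one has [A v = m q] and [D u = m x + e], where [e] is
   small when [x] almost attains the norm.  So [<(A + D) u, v>] is about
   [m (<A q, q> + <D x, x>)], while the two lemmas above bound it by
   [k ^ 2 / 4] times the same factor; in the end [rnorm (A (D x)) / rnorm x]
   stays away from [m]. *)
Lemma opnorm_comp_le : opnorm (A \o D) <= k ^+ 2 / 4.
Proof.
have bAD := bounded_comp bA bD.
set m := opnorm (A \o D); have m0 : 0 <= m by exact: opnorm_ge0.
rewrite leNgt; apply/negP => km.
have mgt0 : 0 < m by apply: le_lt_trans km; rewrite divr_ge0 ?sqr_ge0.
have [_ [a a0 Aa]] := (boundedP A).1 bA; have [_ [d d0 Dd]] := (boundedP D).1 bD.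
set dl := 4 * m - k ^+ 2; have dl0 : 0 < dl by rewrite /dl; lra.
set Q := (4 * a * d) ^+ 2; have Q0 : 0 <= Q by exact: sqr_ge0.
(* Equivalently [dl ^ 2 ||w|| ^ 2 <= Q (m ^ 2 ||x|| ^ 2 - ||w|| ^ 2)]: as [dl > 0], the squared
   ratio [||w|| ^ 2 / ||x|| ^ 2] is at most [Q m ^ 2 / (dl ^ 2 + Q)], which is less than [m ^ 2]. *)
have main x : (dl ^+ 2 + Q) * rnorm (A (D x)) ^+ 2 <= Q * m ^+ 2 * rnorm x ^+ 2.
  set w := A (D x); set v := D x.
  have [q qE] : exists q, q = (m^-1)%:C *: w by exists ((m^-1)%:C *: w).
  set u := A q; set e := D u - m%:C *: x; set c := '[A q, q] + '[D x, x].
  have c1 : '[D x, x] <= c by rewrite /c lerDr positive_rdot.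
  have wq : w = m%:C *: q.
    by rewrite qE scalerA -rmorphM/= divff ?gt_eqF// scale1r.
  have e1 : '[A u + D u, v] = m * c + '[e, v].
    rewrite /e !rdotE (positive_rdotC lA A_ge0 u v) -/w wq !rdotE /c /u /v.
    by rewrite (rdotC _ x (D x)); ring.
  (* Since [u + v = A q + D x], the two lemmas give [4 (m c + <e, v>) <= k ^ 2 c]. *)
  have e2 : dl * c <= 4 * (rnorm e * rnorm v).
    have h1 := le_trans (four_rdot_le u v) (ler_wpM2l k_ge0 (rnorm_sum_sqr_le x q)).
    have := cauchy_schwarz norm_dot (- e) v; rewrite rnormN rdotNl => h2.
    by move: h1; rewrite e1 -/c /dl; lra.
  have e3 : rnorm v ^+ 2 <= d * c.
    exact: le_trans (positive_rnorm_sqr_le x d0 Dd) (ler_wpM2l d0 c1).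
  (* Eliminate [c] between [e2] and [e3], then cancel one factor [rnorm v]. *)
  have e4 : dl * rnorm v <= 4 * d * rnorm e.
    have [->|z0] := eqVneq (rnorm v) 0; first by rewrite mulr0 !mulr_ge0 ?rnorm_ge0.
    have {}z0 : 0 < rnorm v by rewrite lt_def z0 rnorm_ge0.
    rewrite -(ler_pM2r z0).
    have := ler_wpM2l d0 e2; have := ler_wpM2l (ltW dl0) e3; lra.
  (* Expand the square of [e = D A w / m - m x]. The cross term is [-2 <w, A D x> = -2 ||w|| ^ 2],
     and [||D A w|| <= m ||w||]. *)
  have e5 : rnorm e ^+ 2 <= m ^+ 2 * rnorm x ^+ 2 - rnorm w ^+ 2.
    have -> : e = (m^-1)%:C *: (D (A w)) - m%:C *: x.
      by rewrite /e /u qE !(linear_atZ _ _ lA, linear_atZ _ _ lD).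
    rewrite -(rdotxx norm_dot) !rdotE (rdotC _ x).
    rewrite (positive_rdotC lD D_ge0 (A w) x) (positive_rdotC lA A_ge0) -/w !(rdotxx norm_dot).
    have : rnorm (D (A w)) ^+ 2 <= (m * rnorm w) ^+ 2.
      by rewrite ler_sqr ?nnegrE ?mulr_ge0 ?rnorm_ge0// rnorm_comp_le.
    have -> : rnorm (D (A w)) ^+ 2 = m ^+ 2 * (m^-1 * (m^-1 * rnorm (D (A w)) ^+ 2)).
      by field; rewrite gt_eqF.
    rewrite exprMn ler_pM2l ?exprn_gt0// => h.
    set X := m^-1 * _ in h *.
    have -> : m^-1 * - (m * rnorm w ^+ 2) = - rnorm w ^+ 2 by field; rewrite gt_eqF.
    have -> : m^-1 * (m^-1 * (m ^+ 2 * X)) = X by field; rewrite gt_eqF.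
    by lra.
  have e6 : rnorm w <= a * rnorm v by exact: Aa.
  have h : dl ^+ 2 * rnorm w ^+ 2 <= Q * rnorm e ^+ 2.
    rewrite /Q -2!exprMn.
    have dl0' := ltW dl0; rewrite ler_sqr ?nnegrE ?mulr_ge0 ?rnorm_ge0//.
    have := ler_wpM2l dl0' e6; have := ler_wpM2l a0 e4; lra.
  have := ler_wpM2l Q0 e5; move: h; clearbody Q dl; lra.
have dQ : 0 < dl ^+ 2 + Q by rewrite ltr_wpDr// exprn_gt0.
have s0 : 0 <= Q * m ^+ 2 / (dl ^+ 2 + Q).
  by rewrite divr_ge0 ?mulr_ge0 ?sqr_ge0// ltW.
have := opnorm_sqr_le bAD s0; rewrite -/m => /(_ _)/wrap[x|].
  by rewrite mulrAC ler_pdivlMr// mulrC main.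
rewrite ler_pdivlMr// mulrC; apply/negP; rewrite -ltNge.
by rewrite mulrDl -subr_gt0 addrK mulr_gt0 ?exprn_gt0.
Qed.

End NormInequality.

(** * Invertibility and spectrum *)

Section Complete.
Variables (R : realType) (H : completeNormedModType R[i]).

(** Letting [m] tend to infinity in the hypothesis leaves [r n], so the limit comes with an explicit
    rate. *)
Lemma rnorm_complete (u : nat -> H) (r : nat -> R) :
  r n @[n --> \oo] --> (0 : R) ->
  (forall m n, rnorm (u m - u n) <= r m + r n) ->
  exists l, forall n, rnorm (u n - l) <= r n.
Proof.
move=> r0 ur.
have rP (e : R) : 0 < e -> \forall n \near \oo, r n < e.
  move=> e0; move/cvgrPdist_lt : r0 => /(_ _ e0); apply: filterS => n.
  by rewrite sub0r normrN; apply: le_lt_trans; exact: ler_norm.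
have ltE (e : R[i]) : 0 < e -> 0 < complex.Re e /\ e = (complex.Re e)%:C.
  move=> e0; split; first by move: e0; rewrite ltcE => /andP[].
  by rewrite RRe_real// gtr0_real.
have /cauchy_cvgP ucvg : cauchy (u n @[n --> \oo]).
  apply: cauchy_exP => e /ltE[e0 eE].
  have e20 : 0 < complex.Re e / 2 by rewrite divr_gt0.
  have [N _ rN] := rP _ e20.
  exists (u N), N => // n /= Nn; rewrite -ball_normE /= rnormE eE ltcR.
  rewrite (le_lt_trans (ur _ _))// [ltRHS]splitr.
  by rewrite ltrD// rN//= leqnn.
exists (lim (u n @[n --> \oo])) => n; apply/ler_addgt0Pl => e e0.
have e20 : 0 < e / 2 by rewrite divr_gt0.
have eC : 0 < (e / 2)%:C :> R[i] by rewrite ltcR.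
move/cvgrPdist_lt : ucvg => /(_ _ eC) ul.
have [N _ lN] := filterI ul (rP _ e20).
have [] := lN N (leqnn N); rewrite rnormE ltcR => lN1 lN2.
rewrite -(subrK (u N) (u n)) -addrA (le_trans (rnormD _ _))//.
have := ur n N; rewrite (rnormB (u N)).
move: lN1 lN2; lra.
Qed.

Lemma contraction_fixpoint (F : H -> H) (q : R) : 0 <= q -> q < 1 ->
  (forall x y, rnorm (F x - F y) <= q * rnorm (x - y)) -> exists l, F l = l.
Proof.
move=> q0 q1 Fq; pose u n := iter n F 0; pose C := rnorm (0 - F 0) / (1 - q).
have q1' : 0 < 1 - q by rewrite subr_gt0.
have uF n : rnorm (u n - F (u n)) <= q ^+ n * rnorm (0 - F 0).
  elim: n => [|n IH]; first by rewrite expr0 mul1r.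
  by rewrite exprS -mulrA (le_trans (Fq _ _))// ler_wpM2l.
(* This a posteriori estimate shows at once that the iterates form a Cauchy sequence, with no
   geometric series to sum. *)
have xy x y : rnorm (x - y) * (1 - q) <= rnorm (x - F x) + rnorm (y - F y).
  have := rnormD (x - F x) ((F x - F y) + (F y - y)); rewrite !addrA !subrK.
  have := rnormD (F x - F y) (F y - y); rewrite !addrA !subrK (rnormB (F y) y).
  by have := Fq x y; lra.
have r0 : q ^+ n * C @[n --> \oo] --> (0 : R).
  rewrite -(mul0r C); apply: cvgM (cvg_cst C); apply: cvg_expr.
  by rewrite ger0_norm.
have ur m n : rnorm (u m - u n) <= q ^+ m * C + q ^+ n * C.
  have := xy (u m) (u n); have := uF m; have := uF n.
  rewrite /C !mulrA -mulrDl ler_pdivlMr// => *; lra.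
have C0 : 0 <= C by rewrite divr_ge0 ?rnorm_ge0// ltW.
have [l ul] := rnorm_complete r0 ur; exists l; clearbody C.
apply/eqP; rewrite -subr_eq0; apply/eqP/rnorm_eps => e e0.
have e20 : 0 < e / 2 by rewrite divr_gt0.
move/cvgrPdist_lt : r0 => /(_ _ e20)[N _ rN].
have := rN N (leqnn N); have := rN N.+1 (leqnSn N).
have := ul N; have := ul N.+1; rewrite !sub0r !normrN !ger0_norm ?mulr_ge0 ?exprn_ge0//.
have := Fq l (u N); rewrite -/(u N.+1) (rnormB l).
have := rnormD (F l - F (u N)) (u N.+1 - l); rewrite addrA subrK.
have := ler_piMl (rnorm_ge0 (u N - l)) (ltW q1).
move=> *; lra.
Qed.



End Complete.

Section Bounded.
Variables (R : realType) (H : normedModType R[i]).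
Implicit Types (S T V : H -> H).

Lemma bounded_id : bounded_operator (idfun : H -> H).
Proof. by apply/boundedP; split=> //; exists 1 => // x; rewrite mul1r. Qed.

Lemma bounded0 : bounded_operator (0 : H -> H).
Proof.
apply/boundedP; split=> [a x y|]; first by rewrite /= scaler0 addr0.
by exists 0 => // x; rewrite mul0r rnorm0.
Qed.

Lemma bounded_add S T :
  bounded_operator S -> bounded_operator T -> bounded_operator (S + T).
Proof.
move=> /boundedP[lS [a a0 Sa]] /boundedP[lT [b b0 Tb]]; apply/boundedP; split.
  by move=> c x y; rewrite -[LHS]/(S _ + T _) lS lT scalerDr addrACA.
exists (a + b) => [|x]; first exact: addr_ge0.
by rewrite (le_trans (rnormD _ _))// mulrDl lerD.
Qed.

Lemma bounded_scale (a : R[i]) T :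
  bounded_operator T -> bounded_operator (a *: T).
Proof.
move=> /boundedP[lT [b b0 Tb]]; apply/boundedP; split.
  by move=> c x y; rewrite -[LHS]/(a *: T _) lT scalerDr !scalerA mulrC.
have a0 : 0 <= complex.Re `|a| by have := normr_ge0 a; rewrite lecE => /andP[].
exists (complex.Re `|a| * b) => [|x]; first exact: mulr_ge0.
by rewrite -[X in rnorm X]/(a *: T x) rnormZ -mulrA ler_wpM2l.
Qed.

Lemma bounded_sub S T :
  bounded_operator S -> bounded_operator T -> bounded_operator (S - T).
Proof.
by move=> bS bT; rewrite -[- T]scaleN1r; apply/bounded_add/bounded_scale.
Qed.

Lemma invertible_scale (a : R[i]) S : bounded_operator S ->
  invertible_operator (a *: S) -> invertible_operator S.
Proof.
move=> bS [V [bV SV VS]]; exists (a *: V); split; first exact: bounded_scale.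
  apply/funext => x; rewrite -[RHS](congr1 (@^~ x) SV).
  by rewrite -[LHS]/(S (a *: V x)) linear_atZ//; case: bS.
apply/funext => x; rewrite -[RHS](congr1 (@^~ x) VS).
by rewrite -[RHS]/(V (a *: S x)) linear_atZ//; case: bV.
Qed.

(** With [V] the inverse of [S \o T], [T \o V] is a right inverse of [S]; commutation makes [V \o T]
    a left inverse, and the two must coincide. *)
Lemma invertible_factor S T :
  bounded_operator S -> bounded_operator T -> S \o T = T \o S ->
  invertible_operator (S \o T) -> invertible_operator S.
Proof.
move=> bS bT ST [V [bV STV VST]]; exists (T \o V); split.
- exact: bounded_comp.
- exact: STV.
- suff <- : V \o T = T \o V by rewrite -[LHS]/(V \o (T \o S)) -ST.
  rewrite -[LHS]/(V \o T \o idfun) -STV -[LHS]/(V \o ((T \o S) \o T) \o V).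
  by rewrite -ST -[LHS]/((V \o (S \o T)) \o T \o V) VST.
Qed.

Lemma invertible_comp S T :
  invertible_operator S -> invertible_operator T -> invertible_operator (S \o T).
Proof.
move=> [V [bV SV VS]] [W [bW TW WT]]; exists (W \o V); split.
- exact: bounded_comp.
- by rewrite -[LHS]/(S \o (T \o W) \o V) TW.
- by rewrite -[LHS]/(W \o (V \o S) \o T) VS.
Qed.

Lemma invertible_bounded_below S : invertible_operator S ->
  exists2 c : R, 0 <= c & forall x, rnorm x <= c * rnorm (S x).
Proof.
move=> [V [/boundedP[_ [c c0 Vc]] _ VS]]; exists c => // x.
by rewrite (le_trans _ (Vc _))// -[V (S x)]/((V \o S) x) VS.
Qed.

End Bounded.

Section Coercive.
Variables (R : realType) (H : completeNormedModType R[i]).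
Variable dot : {dot H for Num.conj}.
Hypothesis norm_dot : forall x : H, `|x| ^+ 2 = dot x x.
Implicit Types (S T V : H -> H).

(* Lax-Milgram: [x |-> x - tau (S x - y)] is a contraction for small [tau]. *)
Lemma coercive_invertible S (c : R) : bounded_operator S -> 0 < c ->
  (forall x, c * rnorm x ^+ 2 <= rdot dot (S x) x) -> invertible_operator S.
Proof.
move=> bS c0 Sc; have [lS [K0 K00 SK0]] := (boundedP S).1 bS.
(* Adding [c] ensures [K > 0] and [c <= K], hence [0 <= q]. *)
pose K := K0 + c; have K0' : 0 < K by rewrite ltr_wpDl.
have SK x : rnorm (S x) <= K * rnorm x.
  by rewrite (le_trans (SK0 x))// ler_wpM2r ?rnorm_ge0// lerDl ltW.
(* This [tau] minimizes [1 - 2 tau c + tau ^ 2 K ^ 2], the bound on the squared contraction factor;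
   [q] is the minimum. *)
pose tau := c / K ^+ 2; have tau0 : 0 <= tau by rewrite divr_ge0 ?sqr_ge0// ltW.
pose q := 1 - c ^+ 2 / K ^+ 2.
have q0 : 0 <= q.
  rewrite subr_ge0 ler_pdivrMr ?exprn_gt0// mul1r.
  by rewrite ler_sqr ?nnegrE ?(ltW c0) ?(ltW K0')// /K lerDr.
have q1 : q < 1 by rewrite gtrDl oppr_lt0 divr_gt0 ?exprn_gt0.
have step z : rnorm (z - tau%:C *: S z) <= Num.sqrt q * rnorm z.
  rewrite -ler_sqr ?nnegrE ?mulr_ge0 ?rnorm_ge0 ?sqrtr_ge0// exprMn sqr_sqrtr//.
  rewrite -(rdotxx norm_dot) !rdotE (rdotC _ z) !(rdotxx norm_dot).
  have h1 : rnorm (S z) ^+ 2 <= K ^+ 2 * rnorm z ^+ 2.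
    by rewrite -exprMn ler_sqr ?nnegrE ?mulr_ge0 ?rnorm_ge0// ltW.
  have h2 := ler_wpM2l tau0 (Sc z).
  have := ler_wpM2l tau0 (ler_wpM2l tau0 h1).
  have -> : tau * (tau * (K ^+ 2 * rnorm z ^+ 2)) = tau * c * rnorm z ^+ 2.
    by rewrite /tau; field; rewrite gt_eqF.
  have -> : q = 1 - tau * c by rewrite /q /tau; field; rewrite gt_eqF.
  lra.
have surj y : exists x, S x = y.
  have [|||x xE] := @contraction_fixpoint _ _ (fun x => x - tau%:C *: (S x - y)) (Num.sqrt q).
  - exact: sqrtr_ge0.
  - by rewrite -[ltRHS]sqrtr1 ltr_sqrt.
  - move=> x x'; apply: le_trans (step _); rewrite (linear_atB _ _ lS).
    rewrite !scalerBr; set b := _ *: S x; set b' := _ *: S x'; set d := _ *: y.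
    rewrite !opprB [b' - d - x']addrC addrACA [d - b]addrC [- b + d + _]addrACA subrr addr0.
    by rewrite [- b + b']addrC lexx.
  exists x; move/eqP: xE; rewrite -subr_eq0 addrAC subrr add0r oppr_eq0.
  rewrite scaler_eq0 => /orP[|]; last by rewrite subr_eq0 => /eqP.
  move=> /eqP/complexI/eqP; rewrite mulf_eq0 invr_eq0 expf_eq0/=.
  by rewrite !gt_eqF.
have below x : c * rnorm x <= rnorm (S x).
  have [->|x0] := eqVneq (rnorm x) 0; first by rewrite mulr0 rnorm_ge0.
  have {}x0 : 0 < rnorm x by rewrite lt_def x0 rnorm_ge0.
  rewrite -(ler_pM2r x0) -mulrA -expr2.
  exact: le_trans (Sc x) (cauchy_schwarz norm_dot _ _).
have inj x y : S x = S y -> x = y.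
  move=> Sxy; apply/eqP; rewrite -subr_eq0; apply/eqP/rnorm_eq0/eqP.
  rewrite eq_le rnorm_ge0 andbT -(ler_pM2l c0) mulr0.
  by rewrite (le_trans (below _))// linear_atB// Sxy subrr rnorm0.
have [V VE] := choice surj; exists V; split; last 2 first.
- by apply/funext => x; exact: VE.
- by apply/funext => x; apply: inj; exact: VE.
apply/boundedP; split=> [a x y|].
  by apply: inj; rewrite lS !VE.
exists c^-1 => [|x]; first by rewrite invr_ge0 ltW.
by rewrite mulrC ler_pdivlMr// mulrC -{2}(VE x).
Qed.

Lemma positive_spectrum T (l : R[i]) : bounded_operator T ->
  positive_operator dot T -> spectrum T l ->
  l = (complex.Re l)%:C /\ 0 <= complex.Re l <= opnorm T.
Proof.
move=> bT T0 Tl; have lT := bT.1.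
have bTl : bounded_operator (T - l *: idfun).
  exact/bounded_sub/bounded_scale/bounded_id.
(* [u (T - l)] is coercive for a suitable [u] in [{1, -1, 'i, -'i}]. *)
have noncoercive (u : R[i]) (c : R) : 0 < c ->
    (forall x, c * rnorm x ^+ 2 <= complex.Re (u * (dot (T x) x - l * dot x x))) -> False.
  move=> c0 ul; apply: Tl; apply: (@invertible_scale _ _ u) => //.
  apply: (coercive_invertible (bounded_scale u bTl) c0) => x.
  rewrite (le_trans (ul x))// /rdot -[(u *: _) x]/(u *: (T x - l *: x)) dotZl dotDl.
  by rewrite -[- (l *: x)]scaleNr dotZl mulNr.
have TE x : dot (T x) x = (rdot dot (T x) x)%:C.
  by rewrite /rdot [LHS]complexE (positive_Im T0) mulr0 addr0.
have xE x : dot x x = (rnorm x ^+ 2)%:C by rewrite -norm_dot rnormE rmorphXn.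
case: l Tl bTl noncoercive => a b _ _ nc /=.
have b0 : b = 0.
  (* As [dot (T x) x] is real, the real part of the form of ['i (T - l)] at [x] is [b ||x|| ^ 2]. *)
  have [b0|b0|//] := ltgtP b 0; exfalso.
    apply: (nc (-'i) (- b)) => [|x]; first by rewrite oppr_gt0.
    by rewrite TE xE /=; lra.
  apply: (nc 'i b) => // x.
  by rewrite TE xE /=; lra.
split; first by rewrite b0.
apply/andP; split; rewrite leNgt; apply/negP => a0.
  apply: (nc 1 (- a)) => [|x]; first by rewrite oppr_gt0.
  by have := positive_rdot T0 x; rewrite TE xE b0 /=; lra.
apply: (nc (-1) (a - opnorm T)) => [|x]; first by rewrite subr_gt0.
have := cauchy_schwarz norm_dot (T x) x.
have := ler_wpM2r (rnorm_ge0 x) (rnorm_opnorm x bT).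
by rewrite TE xE b0 /=; lra.
Qed.

(** Expanding, [||(S ^ 2 - m ^ 2) x|| ^ 2 <= m ^ 2 (m ^ 2 ||x|| ^ 2 - ||S x|| ^ 2)]. A bounded
    inverse would keep the left side above a multiple of [||x|| ^ 2], hence [||S x||] uniformly
    below [m ||x||]. Squaring [S] avoids deciding which of [m] and [-m] lies in the spectrum. *)
Lemma opnorm_sqr_spectrum S : (exists x : H, x != 0) -> bounded_operator S ->
  (forall x y, rdot dot (S x) y = rdot dot x (S y)) ->
  ~ invertible_operator (S \o S - (opnorm S ^+ 2)%:C *: idfun).
Proof.
move=> [z z0] bS Ssym /invertible_bounded_below[C C0 CS].
set m := opnorm S in CS; have m0 : 0 <= m by exact: opnorm_ge0.
pose C' := C ^+ 2 * m ^+ 2.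
have key x : rnorm x ^+ 2 <= C' * (m ^+ 2 * rnorm x ^+ 2 - rnorm (S x) ^+ 2).
  have : rnorm x ^+ 2 <= C ^+ 2 * rnorm (S (S x) - (m ^+ 2)%:C *: x) ^+ 2.
    by rewrite -exprMn ler_sqr ?nnegrE ?mulr_ge0 ?rnorm_ge0//; exact: CS.
  move=> /le_trans; apply; rewrite /C' -mulrA ler_wpM2l ?sqr_ge0//.
  rewrite -(rdotxx norm_dot) !rdotE (rdotC _ x) !(rdotxx norm_dot) Ssym (rdotxx norm_dot).
  have : rnorm (S (S x)) ^+ 2 <= (m * rnorm (S x)) ^+ 2.
    by rewrite ler_sqr ?nnegrE ?mulr_ge0 ?rnorm_ge0// rnorm_opnorm.
  rewrite exprMn; lra.
have zz : 0 < rnorm z ^+ 2.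
  rewrite exprn_gt0// lt_def rnorm_ge0 andbT; apply/eqP => /rnorm_eq0 zE.
  by rewrite zE eqxx in z0.
have C'0 : 0 < C'.
  rewrite lt_def mulr_ge0 ?sqr_ge0// andbT; apply/eqP => C'E.
  by have := key z; rewrite C'E mul0r leNgt zz.
have := @opnorm_sqr_le _ _ S (m ^+ 2 - C'^-1) bS.
have s0 : 0 <= m ^+ 2 - C'^-1.
  rewrite -(pmulr_rge0 _ C'0) mulrBr divff ?gt_eqF// -(pmulr_lge0 _ zz).
  have := key z; have := mulr_ge0 (ltW C'0) (sqr_ge0 (rnorm (S z))); lra.
move=> /(_ s0); rewrite -/m => h.
suff : m ^+ 2 <= m ^+ 2 - C'^-1.
  by rewrite lerBDr gerDl leNgt invr_gt0 C'0.
apply: h => x; rewrite -(ler_pM2l C'0).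
have -> : C' * ((m ^+ 2 - C'^-1) * rnorm x ^+ 2) = C' * m ^+ 2 * rnorm x ^+ 2 - rnorm x ^+ 2.
  by field; rewrite gt_eqF.
by have := key x; lra.
Qed.

(** In [T ^ 2 - m ^ 2 = (T - m) (T + m)] the second factor is coercive if [m > 0], and equal to the
    first if [m = 0]; so an inverse of [T - m] would invert the product. *)
Lemma opnorm_in_spectrum T : (exists x : H, x != 0) -> bounded_operator T ->
  positive_operator dot T -> real_spectrum T (opnorm T).
Proof.
move=> H0 bT T0 iT; have lT := bT.1; have bI := @bounded_id R H.
apply: (opnorm_sqr_spectrum H0 bT); first exact: positive_rdotC.
set m := opnorm T in iT *; have m0 : 0 <= m by exact: opnorm_ge0.
have -> : T \o T - (m ^+ 2)%:C *: idfun =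
    (T - m%:C *: idfun) \o (T + m%:C *: idfun).
  apply/funext => x.
  rewrite -[LHS]/(T (T x) - (m ^+ 2)%:C *: x).
  rewrite -[RHS]/(T (T x + m%:C *: x) - m%:C *: (T x + m%:C *: x)).
  rewrite (linear_atD _ _ lT) (linear_atZ _ _ lT) scalerDr scalerA -rmorphM/= -expr2 opprD addrA.
  by rewrite addrK.
apply: invertible_comp => //; have [m00|m00] := eqVneq m 0.
  have -> : T + m%:C *: idfun = T - m%:C *: idfun by rewrite m00 !scale0r subr0 addr0.
  exact: iT.
apply: (@coercive_invertible _ m).
- exact/bounded_add/bounded_scale.
- by rewrite lt_def m00.
- move=> x; rewrite -[(_ + _) x]/(T x + m%:C *: x) !rdotE (rdotxx norm_dot).
  by rewrite lerDr positive_rdot.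
Qed.

End Coercive.

(** * Polynomials in an operator *)

Section PolynomialCalculus.
Variables (R : realType) (H : normedModType R[i]) (T : H -> H).
Hypothesis bT : bounded_operator T.
Let lT : linear T := bT.1.

(** Complex coefficients, so that polynomials split into linear factors. *)
Definition cpoly_operator (p : {poly R[i]}) : H -> H :=
  \sum_(i < size p) p`_i *: iter i T.

Implicit Types (x : H) (p q : {poly R[i]}).

Lemma cpoly_operatorE n p x : (size p <= n)%N ->
  cpoly_operator p x = \sum_(i < n) p`_i *: iter i T x.
Proof.
move=> pn; rewrite /cpoly_operator fct_sumE (big_ord_widen _ (fun i => (p`_i *: iter i T) x) pn).
rewrite big_mkcond/=; apply: eq_bigr => i _; case: ltnP => // pi.
by rewrite nth_default// scale0r.
Qed.

Lemma cpoly_operatorD p q x :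
  cpoly_operator (p + q) x = cpoly_operator p x + cpoly_operator q x.
Proof.
rewrite !(@cpoly_operatorE (maxn (size p) (size q))) ?size_polyD ?leq_maxl ?leq_maxr//.
by rewrite -big_split/=; apply: eq_bigr => i _; rewrite coefD scalerDl.
Qed.

Lemma cpoly_operatorC c x : cpoly_operator c%:P x = c *: x.
Proof. by rewrite (@cpoly_operatorE 1) ?size_polyC_leq1// big_ord1 coefC. Qed.

Lemma cpoly_operator0 x : cpoly_operator 0 x = 0.
Proof. by rewrite -polyC0 cpoly_operatorC scale0r. Qed.

Lemma cpoly_operatorMX p x : cpoly_operator (p * 'X) x = cpoly_operator p (T x).
Proof.
rewrite (@cpoly_operatorE (size p).+1); last first.
  by rewrite (leq_trans (size_polyMleq _ _))// size_polyX addn2.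
rewrite big_ord_recl coefMX scale0r add0r (@cpoly_operatorE (size p))//.
by apply: eq_bigr => i _; rewrite coefMX/= -iterSr.
Qed.

Lemma bounded_cpoly p : bounded_operator (cpoly_operator p).
Proof.
elim/poly_ind: p => [|p c IH].
  have -> : cpoly_operator 0 = 0 :> (H -> H) by apply/funext => x; exact: cpoly_operator0.
  exact: bounded0.
rewrite (_ : cpoly_operator _ = cpoly_operator p \o T + c *: idfun).
  apply: bounded_add; first exact: bounded_comp.
  exact/bounded_scale/bounded_id.
by apply/funext => x; rewrite cpoly_operatorD cpoly_operatorMX cpoly_operatorC.
Qed.

Lemma cpoly_operator_comm p x : cpoly_operator p (T x) = T (cpoly_operator p x).
Proof.
elim/poly_ind: p x => [|p c IH] x; first by rewrite !cpoly_operator0 linear_at0.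
rewrite !cpoly_operatorD !cpoly_operatorMX !cpoly_operatorC.
by rewrite IH (linear_atD _ _ lT) (linear_atZ _ _ lT).
Qed.

Lemma cpoly_operatorM p q x :
  cpoly_operator (p * q) x = cpoly_operator p (cpoly_operator q x).
Proof.
elim/poly_ind: p x => [|p c IH] x; first by rewrite mul0r !cpoly_operator0.
rewrite mulrDl -mulrA (mulrC 'X) mulrA !cpoly_operatorD !cpoly_operatorMX IH.
rewrite cpoly_operator_comm cpoly_operatorC; congr (_ + _).
elim/poly_ind: q x {IH} => [|q d IHq] x; first by rewrite mulr0 cpoly_operator0 scaler0.
rewrite mulrDr mulrA -polyCM !cpoly_operatorD !cpoly_operatorMX !cpoly_operatorC.
by rewrite IHq scalerDr scalerA.
Qed.

Lemma cpoly_operatorXsubC a x : cpoly_operator ('X - a%:P) x = T x - a *: x.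
Proof.
rewrite -['X]mul1r -polyCN cpoly_operatorD cpoly_operatorMX -polyC1.
by rewrite !cpoly_operatorC scale1r scaleNr.
Qed.

(** If [T - l] were invertible for every root [l], so would be [p(T)], a nonzero multiple of the
    product of these factors. *)
Lemma cpoly_spectral_mapping p : p != 0 -> ~ invertible_operator (cpoly_operator p) ->
  exists2 l, spectrum T l & root p l.
Proof.
move=> p0; have [r pE] := closed_field_poly_normal p.
have lp0 : lead_coef p != 0 by rewrite lead_coef_eq0.
have rootE l : root p l = (l \in r).
  by rewrite pE rootZ// root_prod_XsubC.
move=> np; apply: contrapT => nl; apply: np.
have bI := @bounded_id R H.
have rinv : {in r, forall l, invertible_operator (T - l *: idfun)}.
  move=> l lr; apply: contrapT => nil; apply: nl; exists l => //.
  by rewrite rootE.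
rewrite pE; move: (lead_coef p) lp0 => c c0; elim: r rinv {pE rootE} => [|l r IH] rinv.
  rewrite big_nil alg_polyC (_ : cpoly_operator _ = c *: idfun); last first.
    by apply/funext => x; rewrite cpoly_operatorC.
  exists (c^-1 *: idfun); split; first exact: bounded_scale.
    by apply/funext => x; rewrite -[LHS]/(c *: (c^-1 *: x)) scalerA divff// scale1r.
  by apply/funext => x; rewrite -[LHS]/(c^-1 *: (c *: x)) scalerA mulVf// scale1r.
rewrite big_cons scalerAr (_ : cpoly_operator _ = (T - l *: idfun) \o
  cpoly_operator (c *: \prod_(z <- r) ('X - z%:P))).
  apply: invertible_comp; first by apply: rinv; rewrite mem_head.
  by apply: IH => z zr; apply: rinv; rewrite inE zr orbT.
by apply/funext => x; rewrite cpoly_operatorM cpoly_operatorXsubC.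
Qed.

(** At a root [l], [p(T)] is a product of [T - l] and an operator commuting with it, and
    [invertible_factor] would invert [T - l]. *)
Lemma cpoly_spectrum_root p l : invertible_operator (cpoly_operator p) ->
  spectrum T l -> ~~ root p l.
Proof.
move=> ip Tl; apply/negP => /factor_theorem[q pE]; apply: Tl.
have E : (T - l *: idfun) \o cpoly_operator q = cpoly_operator p.
  by apply/funext => x; rewrite pE mulrC cpoly_operatorM cpoly_operatorXsubC.
have E' : cpoly_operator q \o (T - l *: idfun) = cpoly_operator p.
  by apply/funext => x; rewrite pE cpoly_operatorM cpoly_operatorXsubC.
apply: (@invertible_factor _ _ _ (cpoly_operator q)).
- exact/bounded_sub/bounded_scale/bounded_id.
- exact: bounded_cpoly.
- by rewrite E E'.
- by rewrite E.
Qed.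

End PolynomialCalculus.

Section RealPolynomialCalculus.
Variables (R : realType) (H : normedModType R[i]) (T : H -> H).
Hypothesis bT : bounded_operator T.
Implicit Types (x : H) (p q : {poly R}).

Lemma poly_operatorE p : poly_operator p T = cpoly_operator T (map_poly (real_complex R) p).
Proof.
rewrite /poly_operator /cpoly_operator size_map_poly; apply: eq_bigr => i _.
by rewrite coef_map.
Qed.

Lemma bounded_poly p : bounded_operator (poly_operator p T).
Proof. by rewrite poly_operatorE; exact: bounded_cpoly. Qed.

Lemma poly_operatorD p q x :
  poly_operator (p + q) T x = poly_operator p T x + poly_operator q T x.
Proof. by rewrite !poly_operatorE rmorphD/= cpoly_operatorD//. Qed.

Lemma poly_operatorC c x : poly_operator c%:P T x = c%:C *: x.
Proof. by rewrite poly_operatorE map_polyC/= cpoly_operatorC//. Qed.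

Lemma poly_operator0 x : poly_operator 0 T x = 0.
Proof. by rewrite -polyC0 poly_operatorC scale0r. Qed.

Lemma poly_operatorMX p x : poly_operator (p * 'X) T x = poly_operator p T (T x).
Proof. by rewrite !poly_operatorE rmorphM/= map_polyX cpoly_operatorMX//. Qed.

Lemma poly_operator_comm p x : poly_operator p T (T x) = T (poly_operator p T x).
Proof. by rewrite poly_operatorE cpoly_operator_comm//. Qed.

Lemma poly_operatorM p q x :
  poly_operator (p * q) T x = poly_operator p T (poly_operator q T x).
Proof. by rewrite !poly_operatorE rmorphM/= cpoly_operatorM//. Qed.

Lemma poly_operatorZ c p x : poly_operator (c *: p) T x = c%:C *: poly_operator p T x.
Proof. by rewrite -mul_polyC poly_operatorM poly_operatorC. Qed.

Lemma poly_operatorB p q x :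
  poly_operator (p - q) T x = poly_operator p T x - poly_operator q T x.
Proof.
by rewrite poly_operatorD -scaleN1r poly_operatorZ rmorphN1 scaleN1r.
Qed.

Lemma poly_operator_sym (dot : {dot H for Num.conj}) p x y :
  (forall x y, rdot dot (T x) y = rdot dot x (T y)) ->
  rdot dot (poly_operator p T x) y = rdot dot x (poly_operator p T y).
Proof.
move=> Ts; elim/poly_ind: p x y => [|p c IH] x y.
  by rewrite !poly_operator0 -(scale0r 0) !rdotE !mul0r.
rewrite !poly_operatorD !poly_operatorMX !poly_operatorC !rdotE IH Ts.
by rewrite poly_operator_comm.
Qed.

End RealPolynomialCalculus.

Lemma poly_operator_affine (R : realType) (H : normedModType R[i]) (T : H -> H)
    (a b : R) (p : {poly R}) : bounded_operator T ->
  poly_operator p (a%:C *: T + b%:C *: idfun) =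
  poly_operator (p \Po (a *: 'X + b%:P)) T.
Proof.
move=> bT.
have bS : bounded_operator (a%:C *: T + b%:C *: idfun).
  by apply: bounded_add; apply: bounded_scale => //; exact: bounded_id.
apply/funext => x; elim/poly_ind: p x => [|p c IH] x.
  by rewrite comp_poly0 !poly_operator0.
rewrite comp_polyD comp_polyM comp_polyX comp_polyC.
rewrite !poly_operatorD// poly_operatorMX// poly_operatorM// !poly_operatorC// IH.
rewrite poly_operatorD// poly_operatorZ// -['X]mul1r poly_operatorMX// -polyC1 !poly_operatorC//.
by rewrite scale1r.
Qed.

Section SpectralBounds.
Variables (R : realType) (H : completeNormedModType R[i]).
Variable dot : {dot H for Num.conj}.
Hypothesis norm_dot : forall x : H, `|x| ^+ 2 = dot x x.
Hypothesis H_neq0 : exists x : H, x != 0.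
Variable T : H -> H.
Hypotheses (bT : bounded_operator T) (T_ge0 : positive_operator dot T).
Implicit Types p : {poly R}.

Lemma real_spectrum_itv r : real_spectrum T r -> 0 <= r <= opnorm T.
Proof. by move=> /(positive_spectrum norm_dot bT T_ge0)[]. Qed.

(* With [m] the norm of [S = p(T)], [S ^ 2 - m ^ 2] is not invertible, and it
   is the value at [T] of the polynomial [p ^ 2 - m ^ 2]. *)
Lemma poly_opnorm_attained p :
  exists2 r, real_spectrum T r & opnorm (poly_operator p T) <= `|p.[r]|.
Proof.
set m := opnorm _; have bp := bounded_poly bT p.
have m0 : 0 <= m by exact: opnorm_ge0.
have rootp r : (p * p - (m ^+ 2)%:P).[r] = 0 -> m <= `|p.[r]|.
  rewrite !hornerE -expr2 => /eqP; rewrite subr_eq0 => /eqP pm.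
  by rewrite -ler_sqr ?nnegrE// real_normK ?num_real// pm.
have nS : ~ invertible_operator (cpoly_operator T
    (map_poly (real_complex R) (p * p - (m ^+ 2)%:P))).
  have psym x y := poly_operator_sym bT p x y (positive_rdotC bT.1 T_ge0).
  have := opnorm_sqr_spectrum norm_dot H_neq0 bp psym.
  apply: contra_not; rewrite -poly_operatorE; congr invertible_operator.
  by apply/funext => x; rewrite poly_operatorB// poly_operatorM// poly_operatorC.
(* When [p * p] is the constant [m ^ 2], any point of the spectrum will do. *)
have [q0|q0] := eqVneq (p * p - (m ^+ 2)%:P) 0.
  exists (opnorm T); first exact: (opnorm_in_spectrum norm_dot).
  by apply: rootp; rewrite q0 horner0.
have [|l Tl /rootP] := cpoly_spectral_mapping bT _ nS.
  by rewrite map_poly_eq0.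
have [-> _] := positive_spectrum norm_dot bT T_ge0 Tl.
set r := complex.Re l in Tl *; rewrite horner_map => /complexI qr.
exists r; last exact: rootp.
by rewrite /real_spectrum/= -(positive_spectrum norm_dot bT T_ge0 Tl).1.
Qed.

(** If [|p(r)|] exceeded the norm of [p(T)], Cauchy-Schwarz would make [p(T) - p(r)] or its opposite
    coercive, although [r] is a root of [p - p(r)] in the spectrum. *)
Lemma le_poly_opnorm p r : real_spectrum T r -> `|p.[r]| <= opnorm (poly_operator p T).
Proof.
move=> Tr; have bp := bounded_poly bT p; set S := poly_operator p T.
rewrite leNgt; apply/negP => Sp.
suff : invertible_operator (cpoly_operator T (map_poly (real_complex R) (p - p.[r]%:P))).
  move=> ip; have := cpoly_spectrum_root bT ip Tr; rewrite rootE horner_map/= !hornerE subrr.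
  by rewrite rmorph0 eqxx.
rewrite -poly_operatorE; set a := p.[r] in Sp *.
have bS := bounded_poly bT (p - a%:P).
have SE x : poly_operator (p - a%:P) T x = S x - a%:C *: x.
  by rewrite poly_operatorB// poly_operatorC.
have Sx x : `|rdot dot (S x) x| <= opnorm S * rnorm x ^+ 2.
  rewrite (le_trans (norm_cauchy_schwarz norm_dot _ _))// expr2 mulrA.
  by rewrite ler_wpM2r ?rnorm_ge0// rnorm_opnorm.
have [a0|a0] := leP 0 a.
  apply: (@invertible_scale _ _ (-1)%:C) => //.
  apply: (@coercive_invertible _ _ _ norm_dot _ (`|a| - opnorm S)).
  - exact: bounded_scale.
  - by rewrite subr_gt0.
  - move=> x; rewrite -[((-1)%:C *: _) x]/((-1)%:C *: (poly_operator (p - a%:P) T x)) SE.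
    rewrite !rdotE (rdotxx norm_dot) (ger0_norm a0).
    by have := Sx x; rewrite ler_norml => /andP[_]; lra.
apply: (@coercive_invertible _ _ _ norm_dot _ (`|a| - opnorm S)) => //.
- by rewrite subr_gt0.
- move=> x; rewrite SE !rdotE (rdotxx norm_dot) (ltr0_norm a0).
  by have := Sx x; rewrite ler_norml => /andP[+ _]; lra.
Qed.

End SpectralBounds.

(** * Uniform approximation and scalar integrals *)

Section Weierstrass.
Variable R : realType.
Implicit Types (phi psi : nat -> R) (n : nat) (x : R).

(* Bernstein polynomial: the expectation of [phi] at a binomial variable with
   parameters [n] and ['X], by conditioning on the first trial. *)
Fixpoint bernstein n phi : {poly R} :=
  if n is n'.+1 then
    (1 - 'X) * bernstein n' phi + 'X * bernstein n' (fun k => phi k.+1)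
  else (phi 0)%:P.

Lemma bernsteinS n phi x : (bernstein n.+1 phi).[x] =
  (1 - x) * (bernstein n phi).[x] + x * (bernstein n (fun k => phi k.+1)).[x].
Proof. by rewrite /= !hornerE. Qed.

Lemma bernstein_affine n phi (a b : R) x :
  (bernstein n (fun k => a + b * phi k)).[x] = a + b * (bernstein n phi).[x].
Proof.
elim: n phi => [|n IH] phi; first by rewrite /= !hornerE.
by rewrite !bernsteinS !IH; ring.
Qed.

Lemma bernstein_le n phi psi x : 0 <= x <= 1 ->
  (forall k, (k <= n)%N -> phi k <= psi k) ->
  (bernstein n phi).[x] <= (bernstein n psi).[x].
Proof.
move=> /andP[x0 x1]; elim: n phi psi => [|n IH] phi psi phipsi.
  by rewrite /= !hornerE phipsi.
rewrite !bernsteinS; apply: lerD; apply: ler_wpM2l => //; rewrite ?subr_ge0//.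
  by apply: IH => k kn; apply: phipsi; exact: leqW.
by apply: IH => k kn; apply: phipsi.
Qed.

(** Second moment of a shifted binomial variable. The shift [a] carries the induction: a successful
    first trial turns [a] into [a + 1]. *)
Lemma bernstein_variance n (a : R) x :
  (bernstein n (fun k => (k%:R + a) ^+ 2)).[x] = (n%:R * x + a) ^+ 2 + n%:R * (x * (1 - x)).
Proof.
elim: n a => [|n IH] a; first by rewrite /= !hornerE; ring.
rewrite bernsteinS IH (_ : (fun k => _) = (fun k => (k%:R + (a + 1)) ^+ 2)).
  by rewrite IH -natr1; ring.
by apply/funext => k; rewrite -natr1; ring.
Qed.

Definition unif_continuous_on (K : R) (h : R -> R) := forall e : R, 0 < e ->
  exists2 d : R, 0 < d & forall x y : R, 0 <= x <= K -> 0 <= y <= K -> `|x - y| < d ->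
    `|h x - h y| < e.

Lemma weierstrass_unit (h : R -> R) (C e : R) :
  (forall x, 0 <= x <= 1 -> `|h x| <= C) -> unif_continuous_on 1 h -> 0 < e ->
  exists p : {poly R}, forall x, 0 <= x <= 1 -> `|p.[x] - h x| <= e.
Proof.
move=> hC huc e0; have e20 : 0 < e / 2 by rewrite divr_gt0.
have [d d0 hd] := huc _ e20.
have C0 : 0 <= C by apply: le_trans (normr_ge0 (h 0)) (hC 0 _); rewrite lexx ler01.
(* Chebyshev's argument: [|h (k / n) - h x| <= e / 2 + Q (k / n - x) ^ 2] for all [k], by uniform
   continuity within distance [d] and by the bound [2 C] beyond; the expectation of the square is
   [x (1 - x) / n]. *)
pose Q := 2 * C / d ^+ 2; have Q0 : 0 <= Q by rewrite divr_ge0 ?sqr_ge0 ?mulr_ge0.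
have [n n0 nQ] : exists2 n, 0 < n%:R :> R & Q / (e / 2) < n%:R.
  by exists (Num.trunc (Q / (e / 2))).+1; [rewrite ltr0n | exact: truncnS_gt].
exists (bernstein n (fun k => h (k%:R / n%:R))) => x x01.
have -> : (bernstein n (fun k => h (k%:R / n%:R))).[x] - h x =
    (bernstein n (fun k => - h x + 1 * h (k%:R / n%:R))).[x].
  by rewrite bernstein_affine; ring.
set phi := fun k => _; pose psi k := e / 2 + Q / n%:R ^+ 2 * (k%:R + - (n%:R * x)) ^+ 2.
have phi_psi k : (k <= n)%N -> `|phi k| <= psi k.
  move=> kn; have kn01 : 0 <= (k%:R / n%:R : R) <= 1.
    by apply/andP; split; [rewrite divr_ge0 ?ler0n | rewrite ler_pdivrMr// mul1r ler_nat].
  have E : Q / n%:R ^+ 2 * (k%:R + - (n%:R * x)) ^+ 2 = Q * (k%:R / n%:R - x) ^+ 2.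
    by field; rewrite gt_eqF.
  rewrite /phi /psi E mul1r addrC; have [xk|xk] := ltP `|k%:R / n%:R - x| d.
    rewrite ltW// (lt_le_trans (hd _ _ kn01 x01 xk))//.
    by rewrite lerDl mulr_ge0 ?sqr_ge0.
  apply: le_trans (_ : 2 * C <= _); last first.
    apply: ler_wpDl; first exact: ltW.
    have -> : 2 * C = Q * d ^+ 2 by rewrite /Q; field; rewrite gt_eqF.
    by apply: ler_wpM2l => //; rewrite -(real_normK (num_real (_ - x))) ler_sqr ?nnegrE// ltW.
  have := ler_normB (h (k%:R / n%:R)) (h x); have := hC _ kn01; have := hC _ x01; lra.
have psiE : (bernstein n psi).[x] <= e.
  rewrite bernstein_affine bernstein_variance subrr expr0n/= add0r.
  have -> : Q / n%:R ^+ 2 * (n%:R * (x * (1 - x))) = Q / n%:R * (x * (1 - x)).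
    by field; rewrite gt_eqF.
  have x1 : x * (1 - x) <= 1.
    by case/andP: x01 => x0 x1; rewrite mulr_ile1 ?subr_ge0// gerBl.
  have Qn : Q / n%:R <= e / 2 by rewrite ler_pdivrMr// mulrC -ler_pdivrMr// ltW.
  rewrite [leRHS]splitr lerD2l (le_trans _ Qn)//.
  by rewrite ler_piMr// divr_ge0// ltW.
rewrite ler_norml; apply/andP; split.
  apply: le_trans (_ : - (bernstein n psi).[x] <= _); first by rewrite lerN2.
  have -> : - (bernstein n psi).[x] = (bernstein n (fun k => 0 + -1 * psi k)).[x].
    by rewrite [RHS](bernstein_affine n psi 0 (-1)); ring.
  apply: bernstein_le => // k kn; rewrite add0r mulN1r lerNl.
  by rewrite (le_trans _ (phi_psi k kn))// -normrN ler_norm.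
apply: le_trans psiE; apply: bernstein_le => // k kn.
by rewrite (le_trans _ (phi_psi k kn))// ler_norm.
Qed.

Lemma weierstrass (K : R) (h : R -> R) (C e : R) : 0 < K ->
  (forall x, 0 <= x <= K -> `|h x| <= C) -> unif_continuous_on K h -> 0 < e ->
  exists p : {poly R}, forall x, 0 <= x <= K -> `|p.[x] - h x| <= e.
Proof.
move=> K0 hC huc e0.
have scale x : 0 <= x <= 1 -> 0 <= K * x <= K.
  by case/andP=> x0 x1; rewrite mulr_ge0 ?(ltW K0)//= ler_piMr// ltW.
have [||p pE] := @weierstrass_unit (fun x => h (K * x)) C e _ _ e0.
- by move=> x /scale; exact: hC.
- move=> e' /huc[d d0 hd]; exists (d / K); first by rewrite divr_gt0.
  move=> x y /scale x1 /scale y1 xy; apply: hd => //.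
  by rewrite -mulrBr normrM gtr0_norm// mulrC -ltr_pdivlMr.
exists (p \Po (K^-1 *: 'X)) => x /andP[x0 xK].
have /pE : 0 <= K^-1 * x <= 1.
  by rewrite mulr_ge0 ?invr_ge0 ?(ltW K0)//= mulrC ler_pdivrMr// mul1r.
move=> h1; rewrite horner_comp hornerZ hornerX; apply: le_trans h1.
by rewrite mulVKf ?gt_eqF.
Qed.

End Weierstrass.

Section ScalarIntegral.
Variable R : realType.
Implicit Types (f g h : R -> R).

(** Compactness is used as a near-covering property, over the filter of moduli tending to [0] from
    the right: a modulus valid near each point becomes one valid on the whole segment. *)
Lemma heine (K : R) h : continuous h -> unif_continuous_on K h.
Proof.
move=> hc e e0; have e20 : 0 < e / 2 by rewrite divr_gt0.
have := @segment_compact R 0 K; rewrite compact_near_coveringP.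
move=> /(_ R (0 : R)^'+ (fun d x => forall y, `|x - y| < d -> `|h x - h y| < e)).
case=> [x _|d /= d0 hd].
  have /cvgrPdist_lt /(_ _ e20) /nbhs_ballP[d /= d0 hd] := hc x.
  have d20 : 0 < d / 2 by rewrite divr_gt0.
  exists (ball x (d / 2), [set d' | d' < d / 2]) => /=.
    by split; [exact: nbhsx_ballx | exact: nbhs_right_lt].
  move=> [x' d'] /= [+ d'd] y x'y; rewrite /ball/= => xx'.
  have h1 : `|h x - h x'| < e / 2.
    by apply: hd; rewrite /ball/= (lt_trans xx')// ltr_pdivrMr// ltr_pMr// ltr1n.
  have h2 : `|h x - h y| < e / 2.
    apply: hd; rewrite /ball/=; have := ler_normD (x - x') (x' - y).
    by rewrite addrA subrK; lra.
  have := ler_normD (h x' - h x) (h x - h y); rewrite addrA subrK (distrC (h x') (h x)); lra.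
have d20 : 0 < d / 2 by rewrite divr_gt0.
exists (d / 2) => // x y xK _ xy.
apply: (hd (d / 2)) => //=.
  by rewrite sub0r normrN gtr0_norm// ltr_pdivrMr// ltr_pMr// ltr1n.
Qed.

Lemma continuous_clamp f : {within `[0, +oo[, continuous f} ->
  continuous (fun x : R => f (Num.max 0 x)).
Proof.
move=> /continuous_within_itvcyP[fc f0] x.
have [x0|x0|->] := ltgtP x 0.
- apply/cvgrPdist_lt => e e0; near=> y.
  have y0 : y < 0 by near: y; exact: lt_nbhsl.
  by rewrite !max_l ?ltW// subrr normr0.
- have xI : x \in `]0, +oo[ by rewrite in_itv/= x0.
  apply/cvgrPdist_lt => e e0.
  have /cvgrPdist_lt /(_ _ e0) fxe := fc x xI; near=> y.
  have y0 : 0 < y by near: y; exact: lt_nbhsr.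
  by rewrite !max_r ?ltW//; near: y.
- apply/cvgrPdist_lt => e e0; rewrite /= maxxx.
  move/cvgrPdist_lt : f0 => /(_ _ e0) [d /= d0 hd].
  apply/nbhs_ballP; exists d => //= y xy; have [y0|y0] := leP y 0.
    by rewrite subrr normr0.
  exact: hd.
Unshelve. all: by end_near. Qed.

(** Integrating from [-1] makes [0] an interior point, so the derivative there is two-sided. *)
Lemma antiderivative g : continuous g ->
  exists F : R -> R, forall t : R, -1 < t -> is_derive t 1 F (g t).
Proof.
move=> gc; exists (fun x => \int[lebesgue_measure]_(t in `[-1, x]) g t) => t t1.
have [||||dF F'] := @continuous_FTC1 R g (BLeft (-1)) t (t + 1).
- by rewrite ltrDl.
- apply: continuous_compact_integrable; first exact: segment_compact.
  exact: continuous_subspaceT.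
- by rewrite ?lteBSide ?bnd_simp /=.
- exact: gc.
by apply: (DeriveDef dF); rewrite -F' derive1E.
Qed.

Lemma derive_mvt (F g : R -> R) (a b : R) : a < b ->
  (forall t : R, a <= t <= b -> is_derive t 1 F (g t)) ->
  exists2 c : R, a <= c <= b & F b - F a = g c * (b - a).
Proof.
move=> ab Fg; have [||c cab E] := @MVT R F g a b ab.
- by move=> x /[!in_itv]/= /andP[ax xb]; apply: Fg; rewrite !ltW.
- apply: derivable_within_continuous => x /[!in_itv]/= xab.
  by have := Fg _ xab; case.
exists c => //; move: cab; rewrite in_itv/= => /andP[ac cb]; by rewrite !ltW.
Qed.

(** On each cell the mean value theorem writes the increment of [F] as [g c] times the length; the
    tag is within [d] of [c], and the errors add up along the partition. *)
Lemma riemann_sum_antiderivative (F g : R -> R) (d e a : R) (s : seq R) (xi : nat -> R) :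
  0 <= e -> path <%R a s ->
  (forall t : R, a <= t <= last a s -> is_derive t 1 F (g t)) ->
  (forall u v : R, a <= u <= last a s -> a <= v <= last a s -> `|u - v| < d -> `|g u - g v| <= e) ->
  (forall i, (i < size s)%N ->
        (a :: s)`_i <= xi i <= s`_i /\ s`_i - (a :: s)`_i < d) ->
  `|\sum_(i < size s) (s`_i - (a :: s)`_i) * g (xi i) - (F (last a s) - F a)|
    <= e * (last a s - a).
Proof.
move=> e0; elim: s a xi => [|b s IH] a xi.
  by rewrite big_ord0 /= !subrr normr0 mulr0.
move=> /= /andP[ab bs] Fg gde xid; rewrite big_ord_recl /=.
have blast : b <= last b s.
  have /order_path_min -/(_ lt_trans)/allP bmin := bs.
  by have := mem_last b s; rewrite inE => /predU1P[->//|/bmin/ltW].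
have [/= h1 h2] := xid 0 (ltn0Sn _).
have [|c cab E] := @derive_mvt F g a b ab.
- by move=> t /andP[ta tb]; apply: Fg; rewrite ta (le_trans tb).
have {}IH : `|\sum_(i < size s) (s`_i - (b :: s)`_i) * g (xi i.+1) - (F (last b s) - F b)|
    <= e * (last b s - b).
  apply: (IH b (fun i => xi i.+1)) => //.
  - by move=> t /andP[tb tl]; apply: Fg; rewrite tl (le_trans _ tb)// ltW.
  - move=> u v /andP[ub ul] /andP[vb vl]; apply: gde; rewrite ?ul ?vl andbT.
      by rewrite (le_trans _ ub)// ltW.
    by rewrite (le_trans _ vb)// ltW.
  - by move=> i si; exact: (xid i.+1).
have gxc : `|g (xi 0) - g c| <= e.
  move: h1 cab => /andP[x1 x2] /andP[c1 c2]; apply: gde.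
  - by rewrite x1 (le_trans x2).
  - by rewrite c1 (le_trans c2).
  - by rewrite ltr_norml; apply/andP; split; move: h2; lra.
set S := \sum_(i < _) _ in IH *.
have -> : (b - a) * g (xi 0) + S - (F (last b s) - F a) =
    (b - a) * (g (xi 0) - g c) + (S - (F (last b s) - F b)).
  by rewrite (_ : F b = F a + g c * (b - a)); [ring | rewrite -E; ring].
rewrite (le_trans (ler_normD _ _))// normrM (ger0_norm (_ : 0 <= b - a)) ?subr_ge0 ?(ltW ab)//.
have ba : 0 <= b - a by rewrite subr_ge0 ltW.
have := ler_wpM2l ba gxc; move: IH; lra.
Qed.


End ScalarIntegral.

(** * Continuous functional calculus *)

Section Opnorm.
Variables (R : realType) (H : normedModType R[i]).
Implicit Types S T : H -> H.

Lemma opnormD S T : bounded_operator S -> bounded_operator T ->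
  opnorm (S + T) <= opnorm S + opnorm T.
Proof.
move=> bS bT; apply: opnorm_le => [|x]; first by rewrite addr_ge0 ?opnorm_ge0.
by rewrite (le_trans (rnormD _ _))// mulrDl lerD ?rnorm_opnorm.
Qed.

Lemma opnormZ (c : R) T : bounded_operator T ->
  opnorm (c%:C *: T) <= `|c| * opnorm T.
Proof.
move=> bT; apply: opnorm_le => [|x]; first by rewrite mulr_ge0 ?opnorm_ge0.
rewrite -[(_ *: T) x]/(c%:C *: T x) rnormZR -mulrA ler_wpM2l//.
exact: rnorm_opnorm.
Qed.

Lemma opnormB S T : bounded_operator S -> bounded_operator T ->
  opnorm (S - T) <= opnorm (T - S).
Proof.
move=> bS bT; have bTS := bounded_sub bT bS.
apply: opnorm_le => [|x]; first exact: opnorm_ge0.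
rewrite -[(S - T) x]/(S x - T x) rnormB -[T x - S x]/((T - S) x).
exact: rnorm_opnorm.
Qed.

Lemma opnorm_triangle S T V : bounded_operator S -> bounded_operator T ->
  bounded_operator V -> opnorm (S - V) <= opnorm (S - T) + opnorm (T - V).
Proof.
move=> bS bT bV; have -> : S - V = (S - T) + (T - V) by rewrite addrA subrK.
by apply: opnormD; exact: bounded_sub.
Qed.

Lemma opnorm0 : opnorm (0 : H -> H) = 0.
Proof.
apply/eqP; rewrite eq_le opnorm_ge0 ?andbT; last exact: bounded0.
by apply: opnorm_le => // x; rewrite mul0r rnorm0.
Qed.

Lemma opnorm_eq0 T : bounded_operator T -> opnorm T <= 0 -> T = 0.
Proof.
move=> bT T0; apply/funext => x; apply: rnorm_eq0; apply/eqP.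
rewrite eq_le rnorm_ge0 andbT (le_trans (rnorm_opnorm _ bT))//.
by rewrite mulr_le0_ge0// rnorm_ge0.
Qed.

(** One polynomial per tolerance replaces the sequence of the definition; conversely, tolerances
    [1 / (n + 1)] rebuild it. *)
Lemma is_cfcP (f : R -> R) T B : bounded_operator T ->
  is_cfc f T B <-> bounded_operator B /\
  forall e : R, 0 < e -> exists2 p : {poly R}, forall x, real_spectrum T x -> `|p.[x] - f x| <= e
    & opnorm (poly_operator p T - B) <= e.
Proof.
move=> bT; split=> [[bB [p [pf pB]]]|[bB pe]]; split=> //.
  move=> e e0; move/cvgrPdist_le : pB => /(_ _ e0) pB.
  have pfe : \forall n \near \oo, forall x, real_spectrum T x -> `|(p n).[x] - f x| < e.
    have : nbhs (f : {uniform` real_spectrum T -> R})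
        [set h : R -> R | forall x, real_spectrum T x -> `|h x - f x| < e].
      apply/uniform_nbhs; exists [set xy | ball xy.1 e xy.2]; split.
        by rewrite -entourage_ballE; exists e.
      by move=> h /= hf x Tx; rewrite distrC; exact: hf.
    by move/pf.
  have [n _ nP] := filterI pB pfe; have [pBn pfn] := nP n (leqnn n).
  exists (p n) => [x /pfn/ltW//|].
  by apply: le_trans pBn; rewrite sub0r normrN ler_norm.
have /choice[p pP] : forall n : nat, exists p : {poly R},
    (forall x, real_spectrum T x -> `|p.[x] - f x| <= n.+1%:R^-1) /\
    opnorm (poly_operator p T - B) <= n.+1%:R^-1.
  by move=> n; have [|p ? ?] := pe n.+1%:R^-1; [rewrite invr_gt0 | exists p].
exists p; split.
  move=> A /uniform_nbhs[E [entE EA]].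
  move: entE; rewrite -entourage_ballE => -[e /= e0 eE].
  have /cvgrPdist_lt /(_ _ e0) := @cvg_harmonic R; apply: filterS => n.
  rewrite sub0r normrN ger0_norm/= ?invr_ge0// => ne; apply: EA => x Tx.
  by apply: eE; rewrite /ball/= distrC (le_lt_trans _ ne)//; apply: (pP n).1.
apply/cvgrPdist_le => e e0.
have /cvgrPdist_le /(_ _ e0) := @cvg_harmonic R; apply: filterS => n.
rewrite !sub0r !normrN ger0_norm/= ?invr_ge0// => ne.
rewrite ger0_norm; first exact: le_trans (pP n).2 ne.
by apply: opnorm_ge0; apply: bounded_sub => //; exact: bounded_poly.
Qed.

End Opnorm.

Section ContinuousCalculus.
Variables (R : realType) (H : completeNormedModType R[i]).
Variable dot : {dot H for Num.conj}.
Hypothesis norm_dot : forall x : H, `|x| ^+ 2 = dot x x.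
Hypothesis H_neq0 : exists x : H, x != 0.
Variable T : H -> H.
Hypotheses (bT : bounded_operator T) (T_ge0 : positive_operator dot T).
Implicit Types (f g : R -> R) (B : H -> H).

Let bpoly p : bounded_operator (poly_operator p T) := bounded_poly bT p.

Lemma is_cfc_ext f g B : (forall x, real_spectrum T x -> f x = g x) ->
  is_cfc f T B -> is_cfc g T B.
Proof.
move=> fg /(is_cfcP _ _ bT)[bB pe]; apply/(is_cfcP _ _ bT); split=> // e /pe[p pf pB].
by exists p => // x Tx; rewrite -fg// pf.
Qed.

Lemma is_cfc0 : is_cfc (fun=> 0) T 0.
Proof.
apply/(is_cfcP _ _ bT); split=> [|e e0]; first exact: bounded0.
exists 0 => [x _|]; first by rewrite horner0 subrr normr0 ltW.
rewrite (_ : _ - _ = 0) ?opnorm0 ?ltW//; apply/funext => x.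
by rewrite -[LHS]/(poly_operator 0 T x - 0) subr0 poly_operator0.
Qed.

Lemma is_cfcD f g B C : is_cfc f T B -> is_cfc g T C ->
  is_cfc (fun x => f x + g x) T (B + C).
Proof.
move=> /(is_cfcP _ _ bT)[bB pe] /(is_cfcP _ _ bT)[bC qe].
apply/(is_cfcP _ _ bT); split=> [|e e0]; first exact: bounded_add.
have e20 : 0 < e / 2 by rewrite divr_gt0.
have [p pf pB] := pe _ e20; have [q qg qC] := qe _ e20; exists (p + q) => [x Tx|].
  rewrite hornerD opprD addrACA [leRHS]splitr.
  by rewrite (le_trans (ler_normD _ _))// lerD ?pf ?qg.
rewrite (_ : _ - _ = (poly_operator p T - B) + (poly_operator q T - C)).
  rewrite [leRHS]splitr; apply: le_trans (opnormD _ _) (lerD pB qC).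
    exact: bounded_sub.
  exact: bounded_sub.
apply/funext => x.
rewrite -[LHS]/(poly_operator (p + q) T x - (B x + C x)) poly_operatorD//.
by rewrite opprD addrACA.
Qed.

Lemma is_cfcZ (c : R) f B : is_cfc f T B ->
  is_cfc (fun x => c * f x) T (c%:C *: B).
Proof.
move=> /(is_cfcP _ _ bT)[bB pe].
apply/(is_cfcP _ _ bT); split=> [|e e0]; first exact: bounded_scale.
(* The [+ 1] covers [c = 0]. *)
have c0 : 0 < `|c| + 1 by rewrite ltr_wpDl.
have ec0 : 0 < e / (`|c| + 1) by rewrite divr_gt0.
have ce : `|c| * (e / (`|c| + 1)) <= e.
  by rewrite mulrA ler_pdivrMr// mulrC ler_pM2l// lerDl.
have [p pf pB] := pe _ ec0; exists (c *: p) => [x Tx|].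
  by rewrite hornerZ -mulrBr normrM (le_trans _ ce)// ler_wpM2l ?pf.
rewrite (_ : _ - _ = c%:C *: (poly_operator p T - B)).
  rewrite (le_trans _ ce)// (le_trans (opnormZ _ (bounded_sub _ _)))//.
  by rewrite ler_wpM2l.
apply/funext => x.
rewrite -[LHS]/(poly_operator (c *: p) T x - c%:C *: B x) poly_operatorZ//.
by rewrite -scalerBr.
Qed.

Lemma is_cfcB f g B C : is_cfc f T B -> is_cfc g T C ->
  is_cfc (fun x => f x - g x) T (B - C).
Proof.
move=> fB /(is_cfcZ (-1)) gC.
have := is_cfcD fB gC; rewrite rmorphN1 scaleN1r.
by apply: is_cfc_ext => x _; rewrite mulN1r.
Qed.

Lemma is_cfc_sum (n : nat) (c : 'I_n -> R) (f : 'I_n -> R -> R) (B : 'I_n -> H -> H) :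
  (forall i, is_cfc (f i) T (B i)) ->
  is_cfc (fun x => \sum_(i < n) c i * f i x) T (\sum_(i < n) (c i)%:C *: B i).
Proof.
elim: n c f B => [|n IH] c f B fB.
  rewrite big_ord0; apply: is_cfc_ext is_cfc0 => x _; by rewrite big_ord0.
rewrite big_ord_recl.
apply: is_cfc_ext (is_cfcD (is_cfcZ (c ord0) (fB ord0)) (IH _ _ _ (fun i => fB (lift ord0 i)))).
by move=> x _; rewrite big_ord_recl.
Qed.

(** With [le_opnorm_cfc], the isometry of the calculus, carried over from polynomials by
    approximation. *)
Lemma opnorm_cfc_le f B c : is_cfc f T B ->
  (forall x, real_spectrum T x -> `|f x| <= c) -> opnorm B <= c.
Proof.
move=> /(is_cfcP _ _ bT)[bB pe] fc; apply/ler_addgt0Pl => e e0.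
have e20 : 0 < e / 2 by rewrite divr_gt0.
have [p pf pB] := pe _ e20.
have [x Tx px] := poly_opnorm_attained norm_dot H_neq0 bT T_ge0 p.
have := opnorm_triangle bB (bpoly p) (@bounded0 _ _); rewrite !subr0.
have := opnormB bB (bpoly p); have := fc x Tx; have := pf x Tx.
have := ler_normD (p.[x] - f x) (f x); rewrite subrK; lra.
Qed.

Lemma le_opnorm_cfc f B x : is_cfc f T B -> real_spectrum T x -> `|f x| <= opnorm B.
Proof.
move=> /(is_cfcP _ _ bT)[bB pe] Tx; apply/ler_addgt0Pl => e e0.
have e20 : 0 < e / 2 by rewrite divr_gt0.
have [p pf pB] := pe _ e20.
have := opnorm_triangle (bpoly p) bB (@bounded0 _ _); rewrite !subr0.
have := le_poly_opnorm norm_dot bT p Tx; have := pf x Tx; rewrite distrC.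
have := ler_normD (f x - p.[x]) p.[x]; rewrite subrK; lra.
Qed.

(** Polynomials uniformly close to [f] on [[0, K]], which contains the spectrum, have values at [T]
    that are Cauchy in operator norm. The limit is taken pointwise, with a rate proportional to
    [rnorm x], which makes it a limit in operator norm. *)
Lemma is_cfc_exists (K C : R) f : 0 < K -> opnorm T <= K ->
  (forall x : R, 0 <= x <= K -> `|f x| <= C) -> unif_continuous_on K f ->
  exists B, is_cfc f T B.
Proof.
move=> K0 TK fC fuc.
have Tx x : real_spectrum T x -> 0 <= x <= K.
  by move=> /(real_spectrum_itv norm_dot bT T_ge0)/andP[-> /le_trans]; exact.
have /choice[p pf] : forall n : nat, exists p : {poly R},
    forall x, 0 <= x <= K -> `|p.[x] - f x| <= n.+1%:R^-1.
  by move=> n; apply: (weierstrass K0 fC fuc); rewrite invr_gt0.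
pose P n := poly_operator (p n) T.
have PP m n : opnorm (P m - P n) <= m.+1%:R^-1 + n.+1%:R^-1.
  have -> : P m - P n = poly_operator (p m - p n) T.
    by apply/funext => x; rewrite poly_operatorB.
  have [x /Tx xK /le_trans ->//] :=
    poly_opnorm_attained norm_dot H_neq0 bT T_ge0 (p m - p n).
  have := pf m x xK; have := pf n x xK; rewrite hornerD hornerN (distrC (p n).[x]).
  have := ler_normD ((p m).[x] - f x) (f x - (p n).[x]); rewrite addrA subrK.
  by move=> /le_trans h1 h2 h3; apply: h1; exact: lerD.
have bP n : bounded_operator (P n) by exact: bpoly.
have rnormP m n x : rnorm (P m x - P n x) <= (m.+1%:R^-1 + n.+1%:R^-1) * rnorm x.
  rewrite -[P m x - P n x]/((P m - P n) x).
  rewrite (le_trans (rnorm_opnorm _ (bounded_sub _ _)))// ler_wpM2r ?rnorm_ge0//.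
have /choice[B BE] : forall x, exists y, forall n, rnorm (P n x - y) <= n.+1%:R^-1 * rnorm x.
  move=> x; apply: rnorm_complete => [|m n]; last by rewrite -mulrDl.
  by rewrite -(mul0r (rnorm x)); apply: cvgM; [exact: cvg_harmonic | exact: cvg_cst].
have small (c e : R) : 0 <= c -> 0 < e -> exists n : nat, n.+1%:R^-1 * c <= e.
  move=> c0 e0; exists (Num.trunc (c / e)).
  rewrite mulrC ler_pdivrMr// mulrC -ler_pdivrMr// ltW//; exact: truncnS_gt.
have lB : linear B.
  move=> a x y; apply/eqP; rewrite -subr_eq0; apply/eqP/rnorm_eps => e e0.
  have c0 : 0 <= rnorm (a *: x + y) + complex.Re `|a| * rnorm x + rnorm y.
    have a0 : 0 <= complex.Re `|a| by have := normr_ge0 a; rewrite lecE => /andP[].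
    by rewrite !addr_ge0 ?mulr_ge0 ?rnorm_ge0.
  have [n ne] := small _ _ c0 e0; apply: le_trans ne.
  have -> : B (a *: x + y) - (a *: B x + B y) =
      - (P n (a *: x + y) - B (a *: x + y)) + (a *: (P n x - B x) + (P n y - B y)).
    rewrite (bP n).1 scalerBr.
    move: (a *: P n x) (a *: B x) (P n y) (B y) (B _) => X X' Y Y' b.
    by rewrite [X - X' + _]addrACA -opprD opprB addrA subrK.
  rewrite (le_trans (rnormD _ _))// rnormN.
  have := rnormD (a *: (P n x - B x)) (P n y - B y); rewrite rnormZ.
  have := BE x n; have := BE y n; have := BE (a *: x + y) n.
  move=> h1 h2 h3 h4.
  have a0 : 0 <= complex.Re `|a| by have := normr_ge0 a; rewrite lecE => /andP[].
  have h5 := ler_wpM2l a0 h3; move: h1 h2 h4 h5; move: (n.+1%:R^-1) => r; lra.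
have bB : bounded_operator B.
  apply/boundedP; split=> //; exists (opnorm (P 0) + 1) => [|x].
    by rewrite addr_ge0 ?opnorm_ge0.
  have := BE x 0; have := rnorm_opnorm x (bP 0).
  have := rnormD (P 0 x) (B x - P 0 x); rewrite addrC subrK (rnormB (B x)) invr1; lra.
exists B; apply/(is_cfcP _ _ bT); split=> // e e0.
have [n ne] := small 1 e ler01 e0; rewrite mulr1 in ne.
exists (p n) => [x /Tx/(pf n)/le_trans ->//|].
apply: opnorm_le => [|x]; first exact: ltW.
by rewrite (le_trans (BE x n))// ler_wpM2r// rnorm_ge0.
Qed.

Lemma cfcP f : (exists B, is_cfc f T B) -> is_cfc f T (cfc f T).
Proof. by move=> [B fB]; exact: (@xgetI _ 0 [set B | is_cfc f T B] B fB). Qed.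

End ContinuousCalculus.

(** * Operator-valued integrals *)

Section OperatorIntegral.
Variables (R : realType) (H : completeNormedModType R[i]).

(** Tagged partitions of every mesh exist, so the condition in [is_opint] is never vacuous;
    uniqueness of the integral rests on this. *)
Lemma fine_partition (d : R) : 0 < d -> exists (s : seq R) (xi : nat -> R),
  itv_partition 0 1 s /\ (forall i, (i < size s)%N ->
    (0 :: s)`_i <= xi i <= s`_i /\ s`_i - (0 :: s)`_i < d).
Proof.
move=> d0; pose n := (Num.trunc d^-1).+1.
have n0 : 0 < n%:R :> R by rewrite ltr0n.
have nd : d^-1 < n%:R by exact: truncnS_gt.
pose s := mkseq (fun i => i.+1%:R / n%:R : R) n.
have sE i : (i < n)%N -> s`_i = i.+1%:R / n%:R by move=> ?; rewrite nth_mkseq.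
have s0E i : (i < n)%N -> (0 :: s)`_i = i%:R / n%:R.
  by case: i => [|i] ?; [rewrite /= mul0r | rewrite /= sE// ltnW].
exists s, (fun i => i%:R / n%:R); split; first split.
- apply/(pathP 0) => i; rewrite size_mkseq => ni.
  by rewrite s0E// sE// ltr_pM2r ?invr_gt0// ltr_nat.
- rewrite (last_nth 0) size_mkseq -[n in (0 :: s)`_n]/(_.+1) [_`__]/= sE//.
  by rewrite divff// gt_eqF.
- move=> i; rewrite size_mkseq => ni; rewrite s0E// sE//; split.
    by rewrite lexx/= ler_pM2r ?invr_gt0// ler_nat.
  rewrite -mulrBl -natrB// subSnn mul1r -(invrK d) ltf_pV2// posrE ?invr_gt0//.
Qed.

Lemma partition_tag (a b : R) (s : seq R) (x : R) (i : nat) :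
  itv_partition a b s -> (i < size s)%N ->
  (a :: s)`_i <= x <= s`_i -> a <= x <= b.
Proof.
move=> sP si /andP[x1 x2].
have si1 : (i < (size s).+1)%N by exact: leqW.
have := itv_partition_nth_ge si1 sP; rewrite (set_nth_default 0)// => h1.
have := @itv_partition_nth_le _ _ a b s i.+1 si sP.
rewrite (set_nth_default 0)//= => h2.
by rewrite (le_trans h1)//= (le_trans x2).
Qed.

Lemma is_opint_unique (G : R -> H -> H) (B C : H -> H) :
  is_opint 0 1 G B -> is_opint 0 1 G C -> B = C.
Proof.
move=> [bG [bB BP]] [_ [bC CP]].
apply/eqP; rewrite -subr_eq0; apply/eqP/opnorm_eq0; first exact: bounded_sub.
apply/ler_addgt0Pl => e e0; rewrite addr0; have e20 : 0 < e / 2 by rewrite divr_gt0.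
have [d1 d10 P1] := BP _ e20; have [d2 d20 P2] := CP _ e20.
have [|s [xi [sP xiP]]] := @fine_partition (Num.min d1 d2).
  by rewrite lt_min d10 d20.
have {}P1 : opnorm (riemann_sum 0 G s xi - B) < e / 2.
  by apply: P1 => // i /xiP[? ]; rewrite lt_min => /andP[].
have {}P2 : opnorm (riemann_sum 0 G s xi - C) < e / 2.
  by apply: P2 => // i /xiP[? ]; rewrite lt_min => /andP[].
have bS : bounded_operator (riemann_sum 0 G s xi).
  apply: (big_ind (@bounded_operator R H)) => [||i _].
  - exact: bounded0.
  - exact: bounded_add.
  - apply: bounded_scale; apply: bG.
    by have [xs _] := xiP i (ltn_ord i); exact: partition_tag sP _ xs.
have := opnorm_triangle bB bS bC; have := opnormB bB bS; move: P1 P2; lra.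
Qed.

Variable dot : {dot H for Num.conj}.
Hypothesis norm_dot : forall x : H, `|x| ^+ 2 = dot x x.
Hypothesis H_neq0 : exists x : H, x != 0.
Variable T : H -> H.
Hypotheses (bT : bounded_operator T) (T_ge0 : positive_operator dot T).

(** A Riemann sum of [G] is the calculus at [T] of the scalar Riemann sum of [g]. Its distance to
    [J] is thus controlled by the scalar error, which is uniform over the spectrum. *)
Lemma is_opint_cfc (G : R -> H -> H) (J : H -> H) (g : R -> R -> R) (h : R -> R) :
  (forall t, 0 <= t <= 1 -> is_cfc (g t) T (G t)) -> is_cfc h T J ->
  (forall x : R, real_spectrum T x -> exists2 F : R -> R,
    (forall t : R, 0 <= t <= 1 -> is_derive t 1 F (g t x)) & h x = F 1 - F 0) ->
  (forall e : R, 0 < e -> exists2 d : R, 0 < d & forall x u v : R,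
    real_spectrum T x -> 0 <= u <= 1 -> 0 <= v <= 1 -> `|u - v| < d ->
    `|g u x - g v x| <= e) ->
  is_opint 0 1 G J.
Proof.
move=> gG hJ hF guc; split=> [t /gG[]//|]; split=> [|e e0]; first by case: hJ.
have e20 : 0 < e / 2 by rewrite divr_gt0.
have [d d0 gd] := guc _ e20; exists d => // s xi sP xiP.
have xi01 i : (i < size s)%N -> 0 <= xi i <= 1.
  by move=> si; have [xs _] := xiP i si; exact: partition_tag sP si xs.
have cS := is_cfc_sum bT (fun i : 'I_(size s) => s`_i - (0 :: s)`_i)
  (fun i => gG _ (xi01 _ (ltn_ord i))).
apply: le_lt_trans (_ : e / 2 < e); last by rewrite ltr_pdivrMr// ltr_pMr// ltr1n.
apply: (opnorm_cfc_le norm_dot H_neq0 bT T_ge0 (is_cfcB bT cS hJ)) => x Tx.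
have [F Fg ->] := hF x Tx; case: sP => sp /eqP slast.
have := @riemann_sum_antiderivative _ F (fun t => g t x) d (e / 2) 0 s xi (ltW e20) sp.
rewrite slast subr0 mulr1; apply => //.
by move=> u v u01 v01; exact: gd.
Qed.

End OperatorIntegral.

(** * Affine images of an operator, and norm bounds for monotone functions *)

Section Affine.
Variables (R : realType) (H : normedModType R[i]).
Variable T : H -> H.
Hypothesis bT : bounded_operator T.

Lemma real_spectrum_affine (a b x : R) : real_spectrum T x ->
  real_spectrum (a%:C *: T + b%:C *: idfun) (a * x + b).
Proof.
move=> Tx iS; apply: Tx; apply: (@invertible_scale _ _ a%:C).
  exact/bounded_sub/bounded_scale/bounded_id.
move: iS; congr invertible_operator; apply/funext => z.
rewrite -[LHS]/(a%:C *: T z + b%:C *: z - (a * x + b)%:C *: z).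
rewrite -[RHS]/(a%:C *: (T z - x%:C *: z)).
rewrite scalerBr scalerA -rmorphM rmorphD scalerDl opprD addrACA.
by rewrite subrr addr0.
Qed.

(** An approximating polynomial [p] for [a T + b] becomes [p] composed with [a X + b], with the same
    operator value. *)
Lemma is_cfc_affine (a b : R) (f : R -> R) (B : H -> H) :
  is_cfc f (a%:C *: T + b%:C *: idfun) B -> is_cfc (fun x => f (a * x + b)) T B.
Proof.
have bS : bounded_operator (a%:C *: T + b%:C *: idfun).
  by apply: bounded_add; apply: bounded_scale => //; exact: bounded_id.
move=> /(is_cfcP _ _ bS)[bB pe]; apply/(is_cfcP _ _ bT); split=> // e /pe[p pf pB].
exists (p \Po (a *: 'X + b%:P)) => [x Tx|]; last by rewrite -poly_operator_affine.
have := pf _ (real_spectrum_affine (a := a) (b := b) Tx).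
by rewrite horner_comp !hornerE.
Qed.

End Affine.

Lemma positive_affine (R : realType) (H : normedModType R[i])
    (dot : {dot H for Num.conj}) (T : H -> H) (a b : R) :
  positive_operator dot T -> 0 <= a -> 0 <= b -> positive_operator dot (a%:C *: T + b%:C *: idfun).
Proof.
move=> T0 a0 b0 x; rewrite -[(_ + _) x]/(a%:C *: T x + b%:C *: x).
by rewrite dotDl !dotZl addr_ge0 ?mulr_ge0 ?ler0c ?T0.
Qed.

Section MonotoneCalculus.
Variables (R : realType) (H : completeNormedModType R[i]).
Variable dot : {dot H for Num.conj}.
Hypothesis norm_dot : forall x : H, `|x| ^+ 2 = dot x x.
Hypothesis H_neq0 : exists x : H, x != 0.
Variable f : R -> R.
Implicit Types (x y t e : R).
Hypotheses (f_ge0 : forall x, 0 <= x -> 0 <= f x)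
  (f_incr : forall x y, 0 <= x -> x <= y -> f x <= f y)
  (f_cont : {within `[0, +oo[, continuous f}).

(* Agrees with [f] on the spectra in play and is continuous on the whole line. *)
Let f0 (x : R) := f (Num.max 0 x).

Let f0E x : 0 <= x -> f0 x = f x.
Proof. by move=> x0; rewrite /f0 max_r. Qed.

Let f0_cont : continuous f0.
Proof. exact: continuous_clamp. Qed.

Let f0_le K x : 0 <= x <= K -> `|f0 x| <= f K.
Proof. by move=> /andP[x0 xK]; rewrite f0E// ger0_norm ?f_ge0// f_incr. Qed.

Lemma is_cfc_monotone (T : H -> H) : bounded_operator T ->
  positive_operator dot T -> is_cfc f T (cfc f T).
Proof.
move=> bT T0; apply: cfcP; pose K := opnorm T + 1.
have K0 : 0 < K by rewrite ltr_wpDl ?opnorm_ge0.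
have TK : opnorm T <= K by rewrite lerDl.
have [B fB] := is_cfc_exists norm_dot H_neq0 bT T0 K0 TK (@f0_le K) (heine K f0_cont).
exists B; apply: is_cfc_ext fB => // x /(real_spectrum_itv norm_dot bT T0)/andP[x0 _].
exact: f0E.
Qed.

Section Interpolation.
Variables (S : H -> H) (N : R).
Hypotheses (bS : bounded_operator S) (S_ge0 : positive_operator dot S).
Hypotheses (N_ge0 : 0 <= N) (N_le : N <= opnorm S).

Let m := opnorm S.
Let G t := cfc f ((1 - t)%:C *: S + (t * N)%:C *: idfun).
Let g t x : R := f0 ((1 - t) * x + t * N).

Let m_ge0 : 0 <= m.
Proof. exact: opnorm_ge0. Qed.

Let conv_itv (K x t : R) : N <= K -> 0 <= x <= K -> 0 <= t <= 1 ->
  0 <= (1 - t) * x + t * N <= K.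
Proof.
move=> NK /andP[x0 xK] /andP[t0 t1]; have t1' : 0 <= 1 - t by rewrite subr_ge0.
rewrite addr_ge0 ?mulr_ge0//=.
have := ler_wpM2l t1' xK; have := ler_wpM2l t0 NK; lra.
Qed.

Let is_cfc_g t : 0 <= t <= 1 -> is_cfc (g t) S (G t).
Proof.
move=> /andP[t0 t1]; have t1' : 0 <= 1 - t by rewrite subr_ge0.
have tN : 0 <= t * N by rewrite mulr_ge0.
have bT : bounded_operator ((1 - t)%:C *: S + (t * N)%:C *: idfun).
  by apply: bounded_add; apply: bounded_scale => //; exact: bounded_id.
have := is_cfc_monotone bT (positive_affine S_ge0 t1' tN).
move=> /(is_cfc_affine bS); apply: is_cfc_ext => // x.
move=> /(real_spectrum_itv norm_dot bS S_ge0)/andP[x0 _].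
by rewrite /g f0E// addr_ge0 ?mulr_ge0.
Qed.

Lemma opint_monotone_calculus :
  f N <= opnorm (opint 0 1 G) /\ opnorm (opint 0 1 G) <= opnorm (cfc f S).
Proof.
pose K := m + 1; have K0 : 0 < K by rewrite ltr_wpDl.
have mK : m <= K by rewrite lerDl.
have NK : N <= K by exact: le_trans mK.
have spec_itv x : real_spectrum S x -> 0 <= x <= m.
  by move=> Tx; exact: (real_spectrum_itv norm_dot bS S_ge0 Tx).
have /choice[F Fg] : forall x, exists F : R -> R,
    forall t : R, 0 <= t <= 1 -> is_derive t 1 F (g t x).
  move=> x; have [|F Fg] := @antiderivative R (fun t => g t x).
    move=> t; apply: continuous_comp; last exact: f0_cont.
    apply: cvgD; apply: cvgM; try exact: cvg_cst; last exact: cvg_id.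
    by apply: cvgB; [exact: cvg_cst | exact: cvg_id].
  by exists F => t /andP[t0 _]; apply: Fg; exact: lt_le_trans t0.
(* [h x] is the integral of [t |-> g t x] over [[0, 1]]. *)
pose h x := F x 1 - F x 0.
have hE x : exists2 t : R, 0 <= t <= 1 & h x = g t x.
  have [t t01 E] := derive_mvt ltr01 (Fg x); exists t => //.
  by rewrite /h E subr0 mulr1.
(* The mean value theorem for [F x - F y] gives one [t] serving both points, and
   [x |-> (1 - t) x + t N] does not increase distances; so the modulus of [f0] works for [h]. *)
have huc : unif_continuous_on K h.
  move=> e e0; have [d d0 fd] := heine K f0_cont e0; exists d => // x y xK yK xy.
  have Fxy t : 0 <= t <= 1 -> is_derive t (1 : R) (F x - F y) (g t x - g t y).
    by move=> t01; have ? := Fg x t t01; have ? := Fg y t t01; exact: is_deriveB.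
  have [t t01 E] := derive_mvt ltr01 Fxy.
  have -> : h x - h y = g t x - g t y.
    move: E; rewrite subr0 mulr1 => <-.
    by rewrite -[(F x - F y) 1]/(F x 1 - F y 1) -[(F x - F y) 0]/(F x 0 - F y 0) /h; ring.
  apply: fd; [exact: conv_itv | exact: conv_itv |].
  have -> : (1 - t) * x + t * N - ((1 - t) * y + t * N) = (1 - t) * (x - y) by ring.
  apply: le_lt_trans xy; rewrite normrM ler_piMl// ger0_norm ?subr_ge0; last by case/andP: t01.
  by rewrite gerBl; case/andP: t01.
have hK x : 0 <= x <= K -> `|h x| <= f K.
  by move=> xK; have [t t01 ->] := hE x; apply: f0_le; exact: conv_itv.
have [J hJ] := is_cfc_exists norm_dot H_neq0 bS S_ge0 K0 mK hK huc.
have GJ : is_opint 0 1 G J.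
  apply: (is_opint_cfc norm_dot H_neq0 bS S_ge0 is_cfc_g hJ).
    by move=> x _; exists (F x); [exact: Fg | rewrite /h].
  (* The argument of [f0] moves with [t] at speed [|N - x| <= K], for every [x] in the spectrum. *)
  move=> e e0; have [d d0 fd] := heine K f0_cont e0; exists (d / K); first by rewrite divr_gt0.
  move=> x u v /spec_itv/andP[x0 xm] u01 v01 uv; rewrite ltW//.
  have xK : 0 <= x <= K by rewrite x0 (le_trans xm).
  apply: fd; [exact: conv_itv | exact: conv_itv |].
  have -> : (1 - u) * x + u * N - ((1 - v) * x + v * N) = (u - v) * (N - x) by ring.
  rewrite normrM; rewrite ltr_pdivlMr// in uv; apply: le_lt_trans uv.
  by rewrite ler_wpM2l// ler_norml; apply/andP; split; move: NK xK N_ge0; lra.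
have -> : opint 0 1 G = J.
  exact: is_opint_unique (@xgetI _ 0 [set B | is_opint 0 1 G B] J GJ) GJ.
have Sm : real_spectrum S m by exact: (opnorm_in_spectrum norm_dot).
have mm : 0 <= m <= m by rewrite m_ge0 lexx.
split.
  apply: le_trans (le_opnorm_cfc norm_dot bS hJ Sm); have [t t01 ->] := hE m.
  have /andP[c0 cm] := conv_itv N_le mm t01.
  rewrite /g f0E// ger0_norm ?f_ge0// f_incr//.
  case/andP: t01 => t0 t1; have t1' : 0 <= 1 - t by rewrite subr_ge0.
  have := ler_wpM2l t1' N_le; rewrite -/m; lra.
apply: le_trans (_ : f m <= _).
  apply: (opnorm_cfc_le norm_dot H_neq0 bS S_ge0 hJ) => x /spec_itv xm.
  have [t t01 ->] := hE x; apply: f0_le; exact: conv_itv.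
rewrite -[f m]ger0_norm ?f_ge0//.
exact: (le_opnorm_cfc norm_dot bS (is_cfc_monotone bS S_ge0) Sm).
Qed.

End Interpolation.
End MonotoneCalculus.

Unset Implicit Arguments.

Theorem theorem3p12 (R : realType) (H : completeNormedModType R[i])
    (dot : {dot H for Num.conj}) (norm_dot : forall x : H, `|x| ^+ 2 = dot x x)
    (H_neq0 : exists x : H, x != 0)
    (A D : H -> H) (bA : bounded_operator A) (bD : bounded_operator D)
    (A_ge0 : positive_operator dot A) (D_ge0 : positive_operator dot D)
    (f : R -> R)
    (f_ge0 : forall x : R, 0 <= x -> 0 <= f x)
    (f_incr : forall x y : R, 0 <= x -> x <= y -> f x <= f y)
    (f_convex : operator_convex dot `[0, +oo[ f) :
  let M : H -> H := 2^-1 *: (A + D) in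
  let N : R := opnorm (A \o D) in
  let I := opint 0 1
    (fun t : R => cfc f ((1 - t)%:C *: (M \o M) + (t * N)%:C *: idfun)) in
  f N <= opnorm I /\ opnorm I <= opnorm (cfc f (M \o M)).
Proof.
move=> M N.
have half : (2^-1 : R[i]) = (2^-1)%:C by rewrite fmorphV rmorph_nat.
have M_ge0 : positive_operator dot M.
  move=> x; rewrite -[M x]/(2^-1 *: (A x + D x)) dotZl dotDl.
  by rewrite mulr_ge0 ?addr_ge0 ?A_ge0 ?D_ge0// half ler0c.
have bM : bounded_operator M by exact/bounded_scale/bounded_add.
have bMM : bounded_operator (M \o M) by exact: bounded_comp.
have Msym := positive_rdotC bM.1 M_ge0.
have MMx x : rdot dot (M (M x)) x = rnorm (M x) ^+ 2.
  by rewrite Msym (rdotxx norm_dot).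
have MM_ge0 : positive_operator dot (M \o M).
  move=> x; rewrite -[(M \o M) x]/(M (M x)) (positive_selfadjoint bM.1 M_ge0).
  by rewrite -norm_dot exprn_ge0.
set m := opnorm (M \o M); have m0 : 0 <= m by exact: opnorm_ge0.
have N0 : 0 <= N by apply/opnorm_ge0/bounded_comp.
have Nm : N <= m.
  (* [k] bounds the norm of [A + D = 2 M], because [||M x|| ^ 2 = <M M x, x> <= m ||x|| ^ 2]; and
     [k ^ 2 / 4] is exactly [m]. *)
  pose k := 2 * Num.sqrt m; have k0 : 0 <= k by rewrite mulr_ge0 ?sqrtr_ge0.
  have -> : m = k ^+ 2 / 4 by rewrite /k exprMn sqr_sqrtr//; field.
  apply: (opnorm_comp_le norm_dot bA bD A_ge0 D_ge0 k0) => x.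
  have -> : A x + D x = (2 : R)%:C *: M x.
    rewrite -[M x]/(2^-1 *: (A x + D x)) half scalerA -rmorphM/= divff ?scale1r//.
  rewrite rnormZR ger0_norm// /k -mulrA ler_pM2l//.
  rewrite -ler_sqr ?nnegrE ?mulr_ge0 ?sqrtr_ge0 ?rnorm_ge0// exprMn sqr_sqrtr//.
  rewrite -MMx (le_trans (cauchy_schwarz norm_dot _ _))// expr2 mulrA.
  by rewrite ler_wpM2r ?rnorm_ge0//; exact: (rnorm_opnorm x bMM).
exact: (opint_monotone_calculus norm_dot H_neq0 f_ge0 f_incr f_convex.1 bMM MM_ge0 N0 Nm).
Qed.
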